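(* Let $(E,\mathcal{P})$ be a random locally convex module over $K$ with base $(\Omega,\mathcal{F},P)$ which is complete with respect to its $(\varepsilon,\lambda)$-topology, and let $G$ be a closed $L^0$-convex subset of $E$. If $G$ is $L^0$-convexly compact, then $G$ is convexly compact, i.e. every family of closed convex subsets of $G$ with the finite intersection property has nonempty intersection.
   Context: $(\Omega,\mathcal{F},P)$ is a probability space, $K=\mathbb{R}$ or $\mathbb{C}$, $L^0(\mathcal{F},K)$ is the algebra of equivalence classes (modulo $P$-a.s. equality) of $K$-valued $\mathcal{F}$-measurable random variables, $L^0=L^0(\mathcal{F},\mathbb{R})$, $L^0_+=\{\xi\in L^0:\xi\ge0\}$. An $L^0$-seminorm on an $L^0(\mathcal{F},K)$-module $E$ is a map $\|\cdot\|:E\to L^0_+$ with $\|\xi x\|=|\xi|\|x\|$ and $\|x+y\|\le\|x\|+\|y\|$. A random locally convex module $(E,\mathcal{P})$ is an $L^0(\mathcal{F},K)$-module $E$ with a family $\mathcal{P}$ of $L^0$-seminorms such that $\bigvee\{\|x\|:\|\cdot\|\in\mathcal{P}\}=0$ iff $x=\theta$. For finite nonempty $\mathcal{Q}\subset\mathcal{P}$ let $\|x\|_{\mathcal{Q}}=\bigvee_{\|\cdot\|\in\mathcal{Q}}\|x\|$; the $(\varepsilon,\lambda)$-topology on $E$ is the Hausdorff linear topology with local base at $\theta$ the sets $\{x: P\{\|x\|_{\mathcal{Q}}<\varepsilon\}>1-\lambda\}$ ($\mathcal{Q}$ finite nonempty, $\varepsilon>0$, $0<\lambda<1$); completeness refers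 to this (linear) topology. $G\subset E$ is $L^0$-convex if $\xi x+(1-\xi)y\in G$ for all $x,y\in G$, $\xi\in L^0$, $0\le\xi\le1$ (in particular $G$ is convex). An $L^0$-convex set $G$ is $L^0$-convexly compact if every family of $L^0$-convex subsets of $G$ which are closed and which has the finite intersection property has nonempty intersection. Convex compactness (in the sense of Žitković) is the analogous property with ''convex'' in place of ''$L^0$-convex'', in the topological vector space $E$ with the $(\varepsilon,\lambda)$-topology. *)

(* Defs.v *)
From HB Require Import structures.
From mathcomp Require Import all_boot all_order all_algebra.
From mathcomp Require Import all_classical all_reals all_analysis.
From mathcomp Require Import complex.
Set Implicit Arguments. Unset Strict Implicit. Unset Printing Implicit Defensive.
Import Order.TTheory GRing.Theory Num.Theory.
Local Open Scope classical_set_scope.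
Local Open Scope ring_scope.

(* The scalar field K is R (isC = false) or C = R[i] (isC = true); in both
   cases K-valued random variables are represented as functions T -> R[i]
   (with identically zero imaginary part in the real case).
   L^0(F,K) is the ring of equivalence classes modulo P-a.s. equality;
   we work with representatives and require every structure to respect
   P-a.s. equality (setoid encoding of the quotient). *)

Section RLCM.
Context {d : measure_display} {T : measurableType d} {R : realType}
  (P : probability T R).

Definition cmod (z : R[i]) : R := Num.sqrt (complex.Re z ^+ 2 + complex.Im z ^+ 2).

Definition aeeq {V : Type} (f g : T -> V) : Prop := {ae P, forall t, f t = g t}.

Definition rvR (f : T -> R) : Prop := measurable_fun setT f.

Definition rvK (isC : bool) (f : T -> R[i]) : Prop :=
  [/\ measurable_fun setT (fun t => complex.Re (f t)),
      measurable_fun setT (fun t => complex.Im (f t)) &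
      (~~ isC -> forall t, complex.Im (f t) = 0)].

Definition toK (f : T -> R) : T -> R[i] := fun t => (f t)%:C%C.

Section Module.
Variables (isC : bool) (E : zmodType) (sm : (T -> R[i]) -> E -> E).

Definition L0_module : Prop :=
  [/\ forall xi eta x, rvK isC xi -> rvK isC eta -> aeeq xi eta -> sm xi x = sm eta x,
      forall xi x y, rvK isC xi -> sm xi (x + y) = sm xi x + sm xi y,
      forall xi eta x, rvK isC xi -> rvK isC eta ->
        sm (fun t => xi t + eta t) x = sm xi x + sm eta x,
      forall xi eta x, rvK isC xi -> rvK isC eta ->
        sm (fun t => xi t * eta t) x = sm xi (sm eta x) &
      forall x, sm (fun _ => 1) x = x].

Definition L0_seminorm (nrm : E -> T -> R) : Prop :=
  [/\ forall x, rvR (nrm x),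
      forall x, {ae P, forall t, 0 <= nrm x t},
      forall xi x, rvK isC xi ->
        aeeq (nrm (sm xi x)) (fun t => cmod (xi t) * nrm x t) &
      forall x y, {ae P, forall t, nrm (x + y) t <= nrm x t + nrm y t}].

Variables (I : Type) (nrm : I -> E -> T -> R).

(* (E, {nrm i}_i) is a random locally convex module over K.
   Since all ||x|| are >= 0, (\/_i ||x||_i = 0) iff ||x||_i = 0 a.s. for every i. *)
Definition RLC_module : Prop :=
  [/\ L0_module,
      forall i, L0_seminorm (nrm i) &
      forall x, (forall i, aeeq (nrm i x) (fun _ => 0)) <-> x = 0].

(* ||x||_Q for a finite nonempty Q (given as a nonempty list of indices) *)
Definition nrmQ (Q : seq I) (x : E) : T -> R :=
  fun t => \big[Num.max/0]_(i <- Q) nrm i x t.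

Definition Unbhd (Q : seq I) (eps lam : R) : set E :=
  [set x | ((1 - lam)%:E < P [set t | (nrmQ Q x t < eps)%R])%E].

Definition basic_param (Q : seq I) (eps lam : R) : Prop :=
  [/\ Q <> [::], 0 < eps, 0 < lam & lam < 1].

Definition el_open (A : set E) : Prop :=
  forall x, A x -> exists Q eps lam, basic_param Q eps lam /\
    forall y, Unbhd Q eps lam (y - x) -> A y.

Definition el_closed (A : set E) : Prop := el_open (~` A).

Definition directed {D : Type} (le : D -> D -> Prop) : Prop :=
  [/\ inhabited D, forall a, le a a, forall a b c, le a b -> le b c -> le a c &
      forall a b, exists c, le a c /\ le b c].

Definition el_cauchy_net {D : Type} (le : D -> D -> Prop) (x : D -> E) : Prop :=
  forall Q eps lam, basic_param Q eps lam ->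
    exists a0, forall a b, le a0 a -> le a0 b -> Unbhd Q eps lam (x a - x b).

Definition el_converges {D : Type} (le : D -> D -> Prop) (x : D -> E) (l : E) : Prop :=
  forall Q eps lam, basic_param Q eps lam ->
    exists a0, forall a, le a0 a -> Unbhd Q eps lam (x a - l).

Definition el_complete : Prop :=
  forall (D : Type) (le : D -> D -> Prop) (x : D -> E),
    directed le -> el_cauchy_net le x -> exists l, el_converges le x l.

(* convexity (E is a K-vector space via constant scalars) *)
Definition convex_set (G : set E) : Prop :=
  forall x y (l : R), G x -> G y -> 0 <= l -> l <= 1 ->
    G (sm (fun _ => l%:C%C) x + sm (fun _ => (1 - l)%:C%C) y).

Definition L0_convex (G : set E) : Prop :=
  forall x y (xi : T -> R), G x -> G y -> rvR xi ->
    {ae P, forall t, 0 <= xi t <= 1} ->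
    G (sm (toK xi) x + sm (toK (fun t => 1 - xi t)) y).

Definition fip {J : Type} (A : J -> set E) : Prop :=
  forall (n : nat) (f : 'I_n -> J), exists x, forall k, A (f k) x.

Definition family_compact (Good : set E -> Prop) (G : set E) : Prop :=
  forall (J : Type) (A : J -> set E),
    (forall j, [/\ Good (A j), el_closed (A j) & A j `<=` G]) ->
    fip A -> exists x, forall j, A j x.

Definition L0_convexly_compact (G : set E) : Prop :=
  L0_convex G /\ family_compact L0_convex G.

Definition convexly_compact (G : set E) : Prop :=
  convex_set G /\ family_compact convex_set G.

End Module.
End RLCM.

(* Main.v *)
(* Let U be an ultrafilter containing the given convex sets A_j. Every L0-linear functional f
   dominated by one of the seminorms attains its extrema on G, by L0-convex compactness, so
   f has a weak limit phi_f along U. Using L0-convex compactness again, some x0 in G satisfies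
   f(x0) >= phi_f for all f. If x0 were not in the closed convex set A_j, the Hahn-Banach
   theorem in a weighted L1 space, with Radon-Nikodym densities, would give f and dl > 0 with
   E f(y) >= E f(x0) + dl for all y in A_j, hence E phi_f >= E f(x0) + dl: a contradiction.
   The weight exists because G is almost surely bounded for each seminorm; this is a uniform
   boundedness principle, proved by summing norming functionals with random signs. *)

(* The sets [A j] are convex for constant coefficients only, so L0-convex compactness cannot be
   applied to them. It is applied to [G] intersected with sublevel sets of random convex functions,
   which are closed and L0-convex; the [A j] enter only through the ultrafilter and the final
   separation. That separation has to be scalar, again because the coefficients are constant:
   Hahn-Banach yields a real functional [F], and the random functional is recovered from the
   dependence of [F (k x)] on the multiplier [k]. The price is integrability: [Ex (w * q)] must be
   finite on the translate of [A j] that is separated from 0, and the weak limit must be tested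
   against the constant 1. The weight [w] serves both purposes. The dual is stable under negation,
   so the inequalities f(x0) >= phi_f for all f are really equalities; the one-sided form makes each
   of them a sublevel condition. *)
Require Import Defs.
From HB Require Import structures.
From mathcomp Require Import all_boot all_order all_algebra.
From mathcomp Require Import all_classical all_reals all_analysis.
From mathcomp Require Import measurable_realfun complex.
From mathcomp Require Import lra ring.
Set Implicit Arguments. Unset Strict Implicit. Unset Printing Implicit Defensive.
Import Order.TTheory GRing.Theory Num.Theory.
Import numFieldNormedType.Exports HBSimple.
Local Open Scope classical_set_scope.
Local Open Scope ring_scope.

(** * Expectations of bounded random variables *)

Section Expectation.
Context {d : measure_display} {T : measurableType d} {R : realType}
  (P : probability T R).
Implicit Types k l : T -> R.

(** The integral is real-valued, with a default value when it is infinite. Hence the [ae_bounded]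
    hypotheses below: every variable whose expectation matters is first multiplied by something that
    makes it bounded. *)
Definition Ex (k : T -> R) : R := \int[P]_t k t.

Definition ae_bounded (k : T -> R) : Prop :=
  rvR k /\ exists C : R, {ae P, forall t, `|k t| <= C}.

Lemma ae_bounded_le k l : rvR k -> ae_bounded l ->
  {ae P, forall t, `|k t| <= `|l t|} -> ae_bounded k.
Proof.
move=> mk [_ [C lC]] kl; split=> //; exists C.
by apply: filterS2 lC kl => t h1 h2; exact: le_trans h2 h1.
Qed.

Lemma ae_bounded_ub k (C : R) : rvR k -> {ae P, forall t, `|k t| <= C} -> ae_bounded k.
Proof. by move=> mk kC; split=> //; exists C. Qed.

Lemma ae_boundedD k l : ae_bounded k -> ae_bounded l -> ae_bounded (fun t => k t + l t).
Proof.
move=> [mk [C kC]] [ml [D lD]]; split; first exact: measurable_funD.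
exists (C + D); apply: filterS2 kC lD => t h1 h2.
by apply: le_trans (ler_normD _ _) _; exact: lerD.
Qed.

Lemma ae_boundedM k l : ae_bounded k -> ae_bounded l -> ae_bounded (fun t => k t * l t).
Proof.
move=> [mk [C kC]] [ml [D lD]]; split; first exact: measurable_funM.
exists (C * D); apply: filterS2 kC lD => t h1 h2.
by rewrite normrM; apply: ler_pM.
Qed.

Lemma ae_bounded_cst (c : R) : ae_bounded (fun=> c).
Proof. by split; [exact: measurable_cst | exists `|c|; exact: aeW]. Qed.

Lemma ae_boundedZ (c : R) k : ae_bounded k -> ae_bounded (fun t => c * k t).
Proof. by apply: ae_boundedM; exact: ae_bounded_cst. Qed.

Lemma ae_boundedN k : ae_bounded k -> ae_bounded (fun t => - k t).
Proof.
move=> [mk [C kC]]; split; first exact: measurable_funN.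
by exists C; apply: filterS kC => t; rewrite normrN.
Qed.

Lemma ae_boundedB k l : ae_bounded k -> ae_bounded l -> ae_bounded (fun t => k t - l t).
Proof. by move=> bk /ae_boundedN; exact: ae_boundedD. Qed.

Lemma ae_bounded_norm k : ae_bounded k -> ae_bounded (fun t => `|k t|).
Proof.
move=> [mk [C kC]]; split; first exact: measurableT_comp.
by exists C; apply: filterS kC => t; rewrite normr_id.
Qed.

Lemma ae_bounded_indic (A : set T) : measurable A -> ae_bounded (\1_A : T -> R).
Proof.
move=> mA; split; first exact: measurable_indic.
exists 1; apply: aeW => t; rewrite indicE.
by case: (t \in A); rewrite ?normr1 ?normr0.
Qed.

Lemma ae_bounded_integrable k : ae_bounded k -> P.-integrable setT (EFin \o k).
Proof.
move=> [mk [C kC]]; apply/integrableP; split; first exact/measurable_EFinP.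
have mnk : measurable_fun setT (fun t => `|k t|) by exact: measurableT_comp.
apply: (@le_lt_trans _ _ (\int[P]_t `|C|%:E)%E).
  apply: ae_ge0_le_integral => //.
  - by apply: measurableT_comp => //; exact/measurable_EFinP.
  by apply: filterS kC => t h _; rewrite /= lee_fin (le_trans h) ?ler_norm.
by rewrite integral_cst //= probability_setT mule1 ltry.
Qed.

Lemma ExE k : ae_bounded k -> (\int[P]_t (k t)%:E)%E = (Ex k)%:E.
Proof.
move=> bk; rewrite /Ex /Rintegral fineK //.
by apply: integrable_fin_num => //; exact: ae_bounded_integrable.
Qed.

Lemma ExD k l : ae_bounded k -> ae_bounded l -> Ex (fun t => k t + l t) = Ex k + Ex l.
Proof. by move=> bk bl; rewrite /Ex RintegralD //; exact: ae_bounded_integrable. Qed.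

Lemma ExZ (c : R) k : ae_bounded k -> Ex (fun t => c * k t) = c * Ex k.
Proof. by move=> bk; rewrite /Ex RintegralZl //; exact: ae_bounded_integrable. Qed.

Lemma ExB k l : ae_bounded k -> ae_bounded l -> Ex (fun t => k t - l t) = Ex k - Ex l.
Proof. by move=> bk bl; rewrite /Ex RintegralB //; exact: ae_bounded_integrable. Qed.

Lemma Ex_cst (c : R) : Ex (fun=> c) = c.
Proof. by rewrite /Ex /Rintegral integral_cst //= probability_setT mule1. Qed.

Lemma Ex_ge0 k : rvR k -> {ae P, forall t, 0 <= k t} -> 0 <= Ex k.
Proof.
move=> mk k0; rewrite /Ex /Rintegral.
have mEk : measurable_fun setT (EFin \o k) by exact/measurable_EFinP.
rewrite (@ae_eq_integral _ _ _ P setT (fun t => (`|k t|)%:E)) //=.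
- by apply: fine_ge0; apply: integral_ge0 => t _; rewrite lee_fin.
- by apply/measurable_EFinP; exact: measurableT_comp.
- by apply: filterS k0 => t h _ /=; rewrite ger0_norm.
Qed.

Lemma Ex_le k l : ae_bounded k -> ae_bounded l -> {ae P, forall t, k t <= l t} ->
  Ex k <= Ex l.
Proof.
move=> bk bl kl; rewrite -subr_ge0 -ExB //; apply: Ex_ge0.
  by apply: measurable_funB; [case: bl | case: bk].
by apply: filterS kl => t; rewrite subr_ge0.
Qed.

Lemma Ex_eq k l : ae_bounded k -> ae_bounded l -> {ae P, forall t, k t = l t} -> Ex k = Ex l.
Proof.
move=> bk bl kl; apply/eqP; rewrite eq_le; apply/andP; split; apply: Ex_le => //.
  by apply: filterS kl => t ->.
by apply: filterS kl => t ->.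
Qed.

Lemma Ex_norm_le k : ae_bounded k -> `|Ex k| <= Ex (fun t => `|k t|).
Proof.
move=> bk; have bn := ae_bounded_norm bk.
rewrite ler_norml -(mulN1r (Ex _)) -ExZ //; apply/andP; split.
  apply: Ex_le => //; first exact: ae_boundedZ.
  by apply: aeW => t /=; rewrite mulN1r lerNnormlW.
by apply: Ex_le => //; apply: aeW => t; exact: ler_norm.
Qed.

Lemma Ex_eq0 k : ae_bounded k -> {ae P, forall t, 0 <= k t} -> Ex k <= 0 ->
  {ae P, forall t, k t = 0}.
Proof.
move=> bk k0 Ek.
have bn := ae_bounded_norm bk.
have E0 : Ex (fun t => `|k t|) = 0.
  apply/eqP; rewrite eq_le; apply/andP; split; last first.
    by apply: Ex_ge0; [case: bn | exact: aeW].
  apply: le_trans Ek; apply: Ex_le => //.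
  by apply: filterS k0 => t h; rewrite ger0_norm.
have /ae_eq_integral_abs : measurable_fun setT (EFin \o k).
  by apply/measurable_EFinP; case: bk.
move=> /(_ P measurableT)[+ _].
have -> : (\int[P]_x `|(EFin \o k) x| = 0)%E by have := ExE bn; rewrite E0.
by move=> /(_ erefl); apply: filterS => t /(_ I) [].
Qed.

Lemma Ex_indic (A : set T) : measurable A -> (Ex \1_A)%:E = P A.
Proof.
by move=> mA; rewrite -ExE; [rewrite integral_indic // setIT | exact: ae_bounded_indic].
Qed.

Lemma measurable_ltr k l : rvR k -> rvR l -> measurable [set t | k t < l t].
Proof.
move=> mk ml; have := @measurable_fun_ltr _ _ _ _ _ _ mk ml measurableT [set true] I.
by rewrite setTI; congr measurable; apply/seteqP; split=> t /= ->.
Qed.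

Lemma measurable_ler k l : rvR k -> rvR l -> measurable [set t | k t <= l t].
Proof.
move=> mk ml; have := @measurable_fun_ler _ _ _ _ _ _ mk ml measurableT [set true] I.
by rewrite setTI; congr measurable; apply/seteqP; split=> t /= ->.
Qed.

End Expectation.

(** * Linear functionals on random variables *)

Section DualL1.
Context {d : measure_display} {T : measurableType d} {R : realType}
  (P : probability T R).
Implicit Types (k v : T -> R).
Local Notation Ex := (Ex P).

Lemma measurable_funV_pos k : rvR k -> (forall t, 0 < k t) -> rvR (fun t => (k t)^-1).
Proof.
move=> mk k0; rewrite /rvR (_ : (fun t => (k t)^-1) = (fun t => expR (- ln (k t)))).
  apply: (measurableT_comp (@measurable_expR R)); apply: measurable_funN.
  exact: (measurableT_comp (@measurable_ln R)).
by apply/funext => t; rewrite expRN lnK // posrE.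
Qed.

(* The extra [1] makes [k] itself bounded, so that every expectation below is finite. *)
Definition test_fun v k : Prop :=
  rvR k /\ ae_bounded P (fun t => k t * (1 + v t)).

Section Density.
Variables (v : T -> R) (Lam : (T -> R) -> R).
Hypotheses (mv : rvR v) (v0 : forall t, 0 <= v t).
Hypothesis LamD : forall k l, test_fun v k -> test_fun v l ->
  Lam (fun t => k t + l t) = Lam k + Lam l.
Hypothesis LamZ : forall (c : R) k, test_fun v k -> Lam (fun t => c * k t) = c * Lam k.
Hypothesis Lam_le : forall k, test_fun v k -> `|Lam k| <= Ex (fun t => `|k t| * v t).

(** Multiplication by [r] turns bounded variables into test functions, so [L] below is a functional
    on bounded variables; [r * v <= 1] makes it continuous for the L1 norm. *)
Let r t : R := (1 + v t)^-1.

Let v1_gt0 t : 0 < 1 + v t. Proof. by rewrite ltr_pwDl. Qed.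
Let v1_neq0 t : 1 + v t != 0. Proof. by rewrite gt_eqF. Qed.
Let r_gt0 t : 0 < r t. Proof. by rewrite invr_gt0. Qed.
Let mr : rvR r.
Proof.
by apply: measurable_funV_pos => //; apply: measurable_funD => //; exact: measurable_cst.
Qed.
Let rv_ge0 t : 0 <= r t * v t. Proof. by rewrite mulr_ge0 // ltW. Qed.
Let rv_le1 t : r t * v t <= 1.
Proof. by rewrite mulrC ler_pdivrMr // mul1r lerDr. Qed.

Let test_r k : ae_bounded P k -> test_fun v (fun t => r t * k t).
Proof.
move=> [mk [C kC]]; split; first exact: measurable_funM.
rewrite (_ : (fun t => _) = k); first by split=> //; exists C.
by apply/funext => t; rewrite mulrAC mulVf // mul1r.
Qed.

Let b_rv : ae_bounded P (fun t => r t * v t).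
Proof.
apply: (@ae_bounded_ub _ _ _ _ _ 1); first exact: measurable_funM.
by apply: aeW => t; rewrite ger0_norm.
Qed.

Let L k := Lam (fun t => r t * k t).

Let LD k l : ae_bounded P k -> ae_bounded P l -> L (fun t => k t + l t) = L k + L l.
Proof.
move=> bk bl; rewrite /L -LamD; [|exact: test_r..].
by congr Lam; apply/funext => t; rewrite mulrDr.
Qed.

Let LZ c k : ae_bounded P k -> L (fun t => c * k t) = c * L k.
Proof.
move=> bk; rewrite /L -LamZ; last exact: test_r.
by congr Lam; apply/funext => t; rewrite mulrCA.
Qed.

Let L_le k : ae_bounded P k -> `|L k| <= Ex (fun t => `|k t| * (r t * v t)).
Proof.
move=> bk; rewrite (_ : (fun t => _) = (fun t => `|r t * k t| * v t)).
  exact/Lam_le/test_r.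
by apply/funext => t; rewrite normrM (ger0_norm (ltW (r_gt0 t))) mulrCA mulrA.
Qed.

Let L_le1 k : ae_bounded P k -> `|L k| <= Ex (fun t => `|k t|).
Proof.
move=> bk; apply: le_trans (L_le bk) _; have bn := ae_bounded_norm bk.
apply: Ex_le => //; first exact: ae_boundedM.
by apply: aeW => t; rewrite ler_piMr.
Qed.

Let L0 : L (fun=> 0) = 0.
Proof.
rewrite (_ : (fun=> 0) = (fun t : T => 0 * (cst 0 : T -> R) t)).
  by rewrite LZ ?mul0r //; exact: ae_bounded_cst.
by apply/funext => t; rewrite mul0r.
Qed.

(* The density is obtained by applying Radon-Nikodym to the charge [A |-> Lam (r * 1_A)],
   which is dominated by [P] because [r * v <= 1]. *)
Let nu (A : set T) : \bar R := (L \1_A)%:E.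

Let nu0 : nu set0 = 0%E.
Proof. by rewrite /nu (_ : \1_set0 = (fun=> 0)) ?L0 //; apply/funext => t; rewrite indic0. Qed.

Let nu_fin A : d.-measurable A -> nu A \is a fin_num. Proof. by []. Qed.

Let nuU A B : measurable A -> measurable B -> A `&` B = set0 ->
  L \1_(A `|` B) = L \1_A + L \1_B.
Proof.
move=> mA mB AB; rewrite -LD; [|exact: ae_bounded_indic..].
congr L; apply/funext => t; rewrite !indicE in_setU.
have [tA|tA] := boolP (t \in A); have [tB|tB] := boolP (t \in B);
  rewrite /= ?addr0 ?add0r //.
by have := in_setI t A B; rewrite AB in_set0 tA tB.
Qed.

(** The error after [n] terms is the value on the remainder [D n], which is at most [P (D n)]; this
    tends to 0 because the remainders decrease to the empty set. *)
Let nu_sigma : semi_sigma_additive nu.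
Proof.
move=> F mF tF mUF.
pose S n := \bigcup_(i < n) F i.
have mS n : measurable (S n) by exact: bigcup_measurable.
have sumE n : (\sum_(0 <= i < n) nu (F i) = (L \1_(S n))%:E)%E.
  elim: n => [|n IH].
    by rewrite big_geq // -nu0 /nu /S; congr (L \1__)%:E; apply/seteqP; split => t // [] i.
  rewrite big_nat_recr //= IH -EFinD -nuU //.
    congr (L \1__)%:E; apply/seteqP; split=> t.
      by move=> [[i /= lin Fi]|Fn]; [exists i => //=; exact: ltnW | exists n => /=].
    move=> [i /=]; rewrite ltnS leq_eqVlt => /orP[/eqP->|lin] Fi; first by right.
    by left; exists i.
  apply/seteqP; split=> t //= [[i /= lin Fi] Fn].
  by have := tF i n I I (ex_intro _ t (conj Fi Fn)) => ein; rewrite ein ltnn in lin.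
have -> : (fun n => (\sum_(0 <= i < n) nu (F i))%E) = (fun n => (L \1_(S n))%:E).
  by apply/funext.
apply/fine_cvgP; split; first exact: nearW.
rewrite /nu /=.
set U := \bigcup_n F n.
pose D n := U `\` S n.
have mD n : measurable (D n) by exact: measurableD.
have SU n : S n `<=` U by apply: bigcup_sub => i _; exact: bigcup_sup.
have LUS n : L \1_U - L \1_(S n) = L \1_(D n).
  have SD0 : S n `&` D n = set0 by apply/seteqP; split=> t //= [h [_ /(_ h)]].
  have UE : U = S n `|` D n by rewrite /D setDUK.
  have LUE : L \1_U = L \1_(S n) + L \1_(D n) by rewrite -nuU // -UE.
  by rewrite LUE [L \1_(S n) + _]addrC addrK.
have muD0 : P (D n) @[n --> \oo] --> 0%E.
  have := @nonincreasing_cvg_mu _ _ _ P D.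
  have -> : \bigcap_n D n = set0.
    apply/seteqP; split=> t //= h; have [[i _ Fi] _] := h 0%N I.
    by have [_] := h i.+1 I; apply; exists i => /=.
  rewrite measure0; apply => //.
  - by rewrite (le_lt_trans (probability_le1 _ _)) // ltry.
  - move=> m n mn; apply/subsetPset => t [Ut nSt]; split => // -[i /= im Fi].
    by apply: nSt; exists i => //=; exact: leq_trans im mn.
have D0 : fine (P (D n)) @[n --> \oo] --> (0 : R).
  by have /fine_cvgP[] := muD0.
apply/cvgrPdist_le => e e0.
near=> n; rewrite /= LUS.
apply: le_trans (L_le1 _) _; first exact: ae_bounded_indic.
have -> : (fun t => `|\1_(D n) t|) = (\1_(D n) : T -> R).
  by apply/funext => t; rewrite indicE ger0_norm.
have -> : Ex \1_(D n) = fine (P (D n)) by rewrite -Ex_indic.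
near: n; move/cvgrPdist_le : D0 => /(_ e e0); apply: filterS => n.
by rewrite sub0r normrN; apply: le_trans; exact: ler_norm.
Unshelve. all: by end_near.
Qed.

HB.instance Definition _ := isCharge.Build _ _ _ nu nu0 nu_fin nu_sigma.

Let nu_dom : nu `<< P.
Proof.
move=> A NA B mB BA; rewrite /nu.
have PB : P B = 0%E by exact: NA.
apply/eqP; rewrite eqe -normr_le0; apply: le_trans (L_le1 _) _.
  exact: ae_bounded_indic.
rewrite (_ : (fun t => _) = (\1_B : T -> R)) //.
  by rewrite -lee_fin Ex_indic // PB.
by apply/funext => t; rewrite indicE ger0_norm.
Qed.

Lemma charge_density : exists g : T -> R, rvR g /\ P.-integrable setT (EFin \o g) /\
  forall A, measurable A -> (L \1_A)%:E = (\int[P]_(t in A) (g t)%:E)%E.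
Proof.
pose G := Radon_Nikodym [the charge _ _ of nu] P.
have fG t : G t \is a fin_num by exact: Radon_Nikodym_fin_num.
have iG : P.-integrable setT G by exact: Radon_Nikodym_integrable.
have GE : EFin \o (fine \o G) = G by apply/funext => t /=; rewrite fineK.
exists (fine \o G); split; first by apply/measurable_EFinP; rewrite GE; case/integrableP: iG.
split; first by rewrite GE.
move=> A mA; rewrite -[LHS]/(nu A) (Radon_Nikodym_integral nu_dom mA).
by apply: eq_integral => t _; rewrite fineK.
Qed.

Let restrict_indic (A : set T) (g : T -> R) : measurable A ->
  (\int[P]_(t in A) (g t)%:E = \int[P]_t (g t * \1_A t)%:E)%E.
Proof.
move=> mA; rewrite integral_mkcond; apply: eq_integral => t _.
rewrite patchE indicE; case: ifP; rewrite ?mulr1 ?mulr0 //.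
Qed.

(** On the set [A] where [g] exceeds [r * v], the integral of the positive difference is at most 0
    by the domination of [L], so [A] is null. The sign [s] lets the same argument serve for [g] and
    [- g]. *)
Let density_ub (g : T -> R) (s : R) : rvR g -> P.-integrable setT (EFin \o g) ->
    (forall A, measurable A -> s * L \1_A = fine (\int[P]_(t in A) (g t)%:E)%E) ->
    `|s| = 1 ->
  {ae P, forall t, g t <= r t * v t}.
Proof.
move=> mg ig gE s1.
pose A := [set t | r t * v t < g t].
have mA : measurable A by apply: measurable_ltr => //; exact: measurable_funM.
have rvA : P.-integrable A (EFin \o (fun t => r t * v t)).
  by apply: (integrableS measurableT) => //; exact: ae_bounded_integrable.
have gA : P.-integrable A (EFin \o g) by exact: (integrableS measurableT).
have iB : P.-integrable A (fun t => (g t - r t * v t)%:E).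
  by under eq_fun do rewrite EFinB; exact: integrableB.
have le0 : (\int[P]_(t in A) (g t - r t * v t)%:E <= 0)%E.
  under eq_integral do rewrite EFinB.
  rewrite integralB_EFin // -(fineK (integrable_fin_num mA gA)) -gE //.
  rewrite restrict_indic // ExE; last by apply: ae_boundedM => //; exact: ae_bounded_indic.
  rewrite -EFinB lee_fin subr_le0.
  apply: le_trans (ler_norm _) _; rewrite normrM s1 mul1r.
  have bA := ae_bounded_indic P mA.
  apply: le_trans (L_le bA) _; apply: Ex_le.
  - by apply: ae_boundedM => //; exact: ae_bounded_norm.
  - exact: ae_boundedM.
  by apply: aeW => t; rewrite mulrC indicE ger0_norm.
have mB : measurable_fun A (fun t => (g t - r t * v t)%:E) by case/integrableP: iB.
have /(ae_eq_integral_abs P mA)[+ _] := mB.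
have -> : (\int[P]_(t in A) `|(g t - r t * v t)%:E| = 0)%E.
  apply/eqP; rewrite eq_le integral_ge0 // andbT; apply: le_trans le0.
  rewrite le_eqVlt; apply/orP; left; apply/eqP; apply: eq_integral => t.
  by rewrite inE => At; rewrite gee0_abs // lee_fin subr_ge0 ltW.
move=> /(_ erefl); apply: filterS => t h; rewrite leNgt; apply/negP => At.
by have /= [] := h At; apply/eqP; rewrite gt_eqF // subr_gt0.
Qed.

Let density_bnd (g : T -> R) : rvR g -> P.-integrable setT (EFin \o g) ->
    (forall A, measurable A -> (L \1_A)%:E = (\int[P]_(t in A) (g t)%:E)%E) ->
  {ae P, forall t, `|g t| <= r t * v t}.
Proof.
move=> mg ig gE.
have h1 : {ae P, forall t, g t <= r t * v t}.
  by apply: (@density_ub g 1) => //; [move=> A mA; rewrite mul1r -gE | rewrite normr1].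
have h2 : {ae P, forall t, - g t <= r t * v t}.
  apply: (@density_ub (fun t => - g t) (-1)); rewrite ?normrN ?normr1 //.
  - exact: measurable_funN.
  - exact: (integrableN ig).
  - move=> A mA; rewrite mulN1r; under eq_integral do rewrite EFinN.
    rewrite (@integralN _ _ _ P A (EFin \o g)); last first.
      by apply: integrable_add_def => //; apply: (integrableS measurableT).
    by rewrite -gE.
by apply: filterS2 h1 h2 => t a b; rewrite ler_norml a andbT lerNl.
Qed.

Let L_sum (I : Type) (s : seq I) (F : I -> T -> R) :
    (forall i, ae_bounded P (F i)) ->
  ae_bounded P (fun t => \sum_(i <- s) F i t) /\
  L (fun t => \sum_(i <- s) F i t) = \sum_(i <- s) L (F i).
Proof.
move=> bF; elim: s => [|i s [IHb IH]].
  rewrite big_nil (_ : (fun t => _) = (fun=> 0)); last by apply/funext => t; rewrite big_nil.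
  by split; [exact: ae_bounded_cst | exact: L0].
rewrite big_cons (_ : (fun t => _) = (fun t => F i t + \sum_(i <- s) F i t)).
  by split; [exact: ae_boundedD | rewrite LD // IH].
by apply/funext => t; rewrite big_cons.
Qed.

Let Ex_sum (I : Type) (s : seq I) (F : I -> T -> R) :
    (forall i, ae_bounded P (F i)) ->
  Ex (fun t => \sum_(i <- s) F i t) = \sum_(i <- s) Ex (F i).
Proof.
move=> bF; elim: s => [|i s IH].
  rewrite big_nil (_ : (fun t => _) = (fun=> 0)); last by apply/funext => t; rewrite big_nil.
  exact: Ex_cst.
rewrite big_cons (_ : (fun t => _) = (fun t => F i t + \sum_(i <- s) F i t)).
  by rewrite ExD // ?IH //; have [] := L_sum s bF.
by apply/funext => t; rewrite big_cons.
Qed.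

Lemma dual_L1 : exists g : T -> R,
  [/\ rvR g, forall t, `|g t| <= v t &
      forall k, test_fun v k -> Lam k = Ex (fun t => k t * g t)].
Proof.
have [g [mg [ig gE]]] := charge_density.
have gb := density_bnd mg ig gE.
have bg : ae_bounded P g.
  apply: ae_bounded_le mg b_rv _; apply: filterS gb => t.
  by rewrite (ger0_norm (rv_ge0 t)).
have LA A : measurable A -> L \1_A = Ex (fun t => \1_A t * g t).
  move=> mA; apply: EFin_inj; rewrite gE // restrict_indic // -ExE.
    by apply: eq_integral => t _; rewrite mulrC.
  by apply: ae_boundedM => //; exact: ae_bounded_indic.
have bsf (s : {sfun T >-> R}) : ae_bounded P (s : T -> R).
  split; first exact: measurable_funP.
  have [M [_ /= bdM]] := simple_bounded s.
  by exists (`|M| + 1); apply: aeW => t; apply: bdM => //; rewrite ltr_pwDr // ler_norm.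
have Ls (s : {sfun T >-> R}) : L (s : T -> R) = Ex (fun t => s t * g t).
  have sE : (s : T -> R) = (fun t => \sum_(y <- finmap.enum_fset (fset_set (range s)))
      y * \1_(s @^-1` [set y]) t).
    by apply/funext => t; rewrite fimfunE fsbig_finite.
  have mI y : ae_bounded P (\1_(s @^-1` [set y]) : T -> R).
    by apply: ae_bounded_indic; exact: measurable_sfunP.
  rewrite [in RHS](_ : (fun t => s t * g t) = (fun t =>
    \sum_(y <- finmap.enum_fset (fset_set (range s)))
      y * (\1_(s @^-1` [set y]) t * g t))); last first.
    by apply/funext => t; rewrite {1}sE mulr_suml; apply: eq_bigr => y _; rewrite mulrA.
  rewrite (congr1 L sE) (L_sum _ _).2; last by move=> y; exact/ae_boundedZ/mI.
  rewrite Ex_sum; last by move=> y; apply: ae_boundedZ; apply: ae_boundedM => //; exact: mI.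
  apply: eq_bigr => y _; rewrite LZ ?ExZ; [|apply: ae_boundedM => //; exact: mI|exact: mI].
  by rewrite LA //; exact: measurable_sfunP.
(* Both sides are continuous for the L1 norm, since [g] is bounded by 1 almost surely, so the
   equality extends from simple functions. *)
have Lk k : ae_bounded P k -> L k = Ex (fun t => k t * g t).
  move=> bk; have [s [is_ _ s0]] :=
    approximation_sfun_integrable measurableT (ae_bounded_integrable bk).
  have bks n : ae_bounded P (fun t => k t - s n t) by exact: ae_boundedB.
  have bksn n := ae_bounded_norm (bks n).
  have est n : `|L k - Ex (fun t => k t * g t)| <= 2 * Ex (fun t => `|k t - s n t|).
    have -> : L k = L (fun t => k t - s n t) + L (s n).
      by rewrite -LD //; congr L; apply/funext => t; rewrite subrK.
    have -> : Ex (fun t => k t * g t) =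
        Ex (fun t => (k t - s n t) * g t) + Ex (fun t => s n t * g t).
      rewrite -ExD; [|exact: ae_boundedM..].
      by congr Ex; apply/funext => t; rewrite -mulrDl subrK.
    rewrite Ls opprD addrACA subrr addr0 (le_trans (ler_normB _ _)) //.
    rewrite mulr_natl mulr2n lerD //; first exact: L_le1.
    apply: le_trans (Ex_norm_le _) _; first exact: ae_boundedM.
    apply: Ex_le => //; first by apply: ae_bounded_norm; exact: ae_boundedM.
    apply: filterS gb => t h; rewrite normrM ler_piMr //.
    exact: le_trans h (rv_le1 t).
  have E0 : Ex (fun t => `|k t - s n t|) @[n --> \oo] --> (0 : R).
    move: s0; rewrite (_ : (fun n => _) = (fun n => (Ex (fun t => `|k t - s n t|))%:E)).
      by move=> /fine_cvgP[].
    by apply/funext => n; rewrite -ExE.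
  apply/eqP; rewrite -subr_eq0 -normr_le0; apply/ler_addgt0Pr => e e0; rewrite add0r.
  have e2 : 0 < e / 2 by rewrite divr_gt0.
  move/cvgrPdist_le : E0 => /(_ _ e2) [n _ /(_ n (leqnn n))] /=.
  rewrite sub0r normrN => h; apply: le_trans (est n) _.
  rewrite -ler_pdivlMl // mulrC; apply: le_trans h; exact: ler_norm.
(* [g] is the density of [L], so undoing the factor [r] gives the density of [Lam]. Truncation to
   the interval from [- v] to [v] changes it on a null set only, and makes the bound hold at every
   point. *)
pose gg t := (1 + v t) * g t.
pose h t := Num.max (- v t) (Num.min (v t) (gg t)).
have mv1 : rvR (fun t => 1 + v t) by apply: measurable_funD => //; exact: measurable_cst.
have mgg : rvR gg by exact: measurable_funM.
have hgg : {ae P, forall t, h t = gg t}.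
  apply: filterS gb => t; rewrite ler_norml => /andP[a b].
  have rE : (1 + v t) * (r t * v t) = v t by rewrite mulrA mulfV // mul1r.
  have gv : gg t <= v t by rewrite /gg -[leRHS]rE ler_pM2l.
  have vg : - v t <= gg t by rewrite /gg -[in leLHS]rE -mulrN ler_pM2l.
  by rewrite /h min_r // max_r.
exists h; split.
- apply: measurable_maxr; first exact: measurable_funN.
  exact: measurable_minr.
- move=> t; rewrite ler_norml /h le_max lexx /= ge_max ge_min lexx andbT.
  by rewrite (le_trans _ (v0 t)) // oppr_le0.
- move=> k [mk bk].
  have -> : Lam k = L (fun t => k t * (1 + v t)).
    by congr Lam; apply/funext => t; rewrite mulrCA mulVf // mulr1.
  rewrite Lk //.
  have bkg : ae_bounded P (fun t => k t * (1 + v t) * g t) by exact: ae_boundedM.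
  have ae_h : {ae P, forall t, k t * (1 + v t) * g t = k t * h t}.
    by apply: filterS hgg => t ->; rewrite /gg mulrA.
  apply: Ex_eq => //; apply: ae_bounded_le bkg _.
    apply: measurable_funM => //; apply: measurable_maxr; first exact: measurable_funN.
    exact: measurable_minr.
  by apply: filterS ae_h => t ->.
Qed.

End Density.
End DualL1.

(** * The Hahn-Banach theorem on a subspace *)

Section HahnBanach.
Context {R : realType} {L : lmodType R}.
Implicit Types (V C : set L) (s p : L -> R).

Definition linear_subspace V : Prop :=
  [/\ V 0, forall x y, V x -> V y -> V (x + y) & forall (t : R) x, V x -> V (t *: x)].

(** Homogeneity is asked as an inequality only, which is easier to check for infima; equality
    follows by applying it to the inverse scalar ([sublinearZ]). *)
Definition sublinear_on V s : Prop :=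
  (forall x y, V x -> V y -> s (x + y) <= s x + s y) /\
  (forall (t : R) x, 0 <= t -> V x -> s (t *: x) <= t * s x).

Section Sublinear.
Variables (V : set L) (s : L -> R).
Hypotheses (sV : linear_subspace V) (ss : sublinear_on V s).

Lemma sublinear0 : s 0 = 0.
Proof.
case: sV ss => V0 _ _ [sD sZ]; apply/eqP; rewrite eq_le; apply/andP; split.
  by have := sZ 0 0 (lexx _) V0; rewrite scale0r mul0r.
by have := sD 0 0 V0 V0; rewrite addr0 -{1}(addr0 (s 0)) lerD2l.
Qed.

Lemma sublinearZ (t : R) x : 0 <= t -> V x -> s (t *: x) = t * s x.
Proof.
case: sV ss => V0 VD VZ [sD sZ] t0 Vx; apply/eqP; rewrite eq_le sZ //=.
have [->|tn0] := eqVneq t 0; first by rewrite mul0r scale0r sublinear0.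
have {}t0 : 0 < t by rewrite lt_def tn0.
have := sZ t^-1 (t *: x) _ (VZ _ _ Vx).
rewrite scalerA mulVf ?gt_eqF // scale1r ler_pdivlMl //; apply.
by rewrite invr_ge0 ltW.
Qed.

Lemma sublinear_opp x : V x -> 0 <= s x + s (- x).
Proof.
case: sV ss => V0 VD VZ [sD sZ] Vx.
have VNx : V (- x) by rewrite -scaleN1r; exact: VZ.
by rewrite -sublinear0 -(subrr x); exact: sD.
Qed.

End Sublinear.

(** Common core of three constructions: the lower bound of a chain, the perturbation showing that a
    minimal functional is odd, and the functional that encodes the set to be separated. The minorant
    [b] keeps the infimum finite. *)
Lemma sublinear_inf V (I : Type) (D : set I) (phi : I -> L -> R) (b : L -> R) :
    linear_subspace V -> D !=set0 ->
    (forall i x, D i -> V x -> b x <= phi i x) ->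
    (forall i j x y, D i -> D j -> V x -> V y ->
       exists2 k, D k & phi k (x + y) <= phi i x + phi j y) ->
    (forall i (c : R) x, D i -> 0 <= c -> V x ->
       exists2 k, D k & phi k (c *: x) <= c * phi i x) ->
  exists s, [/\ sublinear_on V s, forall i x, D i -> V x -> s x <= phi i x &
    forall x, V x -> b x <= s x].
Proof.
move=> [V0 VD VZ] [i0 Di0] lb phiD phiZ.
pose s x := inf [set phi i x | i in D].
have s_le i x : D i -> V x -> s x <= phi i x.
  move=> Di Vx; apply: ge_inf; last by exists i.
  by exists (b x) => _ [j Dj <-]; exact: lb.
have le_s x a : V x -> (forall i, D i -> a <= phi i x) -> a <= s x.
  move=> Vx h; apply: lb_le_inf; first by exists (phi i0 x), i0.
  by move=> _ [j Dj <-]; exact: h.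
exists s; split=> //; last by move=> x Vx; apply: le_s => // i Di; exact: lb.
split=> [x y Vx Vy|t x t0 Vx].
  rewrite -lerBlDr; apply: (le_s) => // i Di; rewrite lerBlDr -lerBlDl.
  apply: le_s => // j Dj; rewrite lerBlDl.
  have [k Dk] := phiD i j x y Di Dj Vx Vy; apply: le_trans; apply: s_le => //; exact: VD.
have [t00|tn0] := eqVneq t 0.
  have [k Dk] := phiZ i0 t x Di0 t0 Vx; rewrite t00 !mul0r.
  by apply: le_trans; apply: s_le => //; exact: VZ.
have {}t0 : 0 < t by rewrite lt_def tn0.
rewrite -ler_pdivrMl //; apply: le_s => // i Di; rewrite ler_pdivrMl //.
have [k Dk] := phiZ i t x Di (ltW t0) Vx.
by apply: le_trans; apply: s_le => //; exact: VZ.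
Qed.

(* A minimal sublinear functional is linear, and Zorn's lemma provides one below [p]. *)
Lemma hahn_banach_sublinear V p : linear_subspace V -> sublinear_on V p ->
  exists F : L -> R, [/\ forall x y, V x -> V y -> F (x + y) = F x + F y,
    forall (t : R) x, V x -> F (t *: x) = t * F x & forall x, V x -> F x <= p x].
Proof.
move=> sV sp; have [V0 VD VZ] := sV.
have VN x : V x -> V (- x) by move=> Vx; rewrite -scaleN1r; exact: VZ.
pose X := {s : L -> R | sublinear_on V s /\ forall x, V x -> s x <= p x}.
(* The order is reversed, so the maximal element given by Zorn's lemma is a minimal functional. *)
pose le_op (s s' : X) : bool := `[< forall x, V x -> sval s' x <= sval s x >].
have [||A totA|[s [ss sp']] smin] := @ZL_preorder X (exist _ p (conj sp (fun x _ => lexx _))) le_op.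
- by move=> s; apply/asboolP.
- move=> s s' s'' /asboolP h /asboolP h'; apply/asboolP => x Vx.
  by apply: le_trans (h _ Vx); exact: h'.
- have [[a0 Aa0]|A0] := pselect (A !=set0); last first.
    by exists (exist _ p (conj sp (fun x _ => lexx _))) => s As; case: A0; exists s.
  have [|i x _ Vx|i j x y Ai Aj Vx Vy|i c x Ai c0 Vx|s [ss s_le _]] :=
      @sublinear_inf V X A (fun i => sval i) (fun x => - p (- x)) sV.
  + by exists a0.
  + case: i => s [ss sp'] /=; rewrite lerNl.
    have := sublinear_opp sV ss Vx; rewrite -lerBlDl sub0r => /le_trans; apply.
    by apply: sp'; exact: VN.
  + have [/asboolP ij|/asboolP ji] := totA _ _ Ai Aj.
      exists j => //; case: j Aj ij => j [[jD jZ] jp] Aj /= ij.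
      by apply: le_trans (jD _ _ Vx Vy) _; rewrite lerD2r; exact: ij.
    exists i => //; case: i Ai ji => i [[iD iZ] ip] Ai /= ji.
    by apply: le_trans (iD _ _ Vx Vy) _; rewrite lerD2l; exact: ji.
  + by exists i => //; have [[_ iZ] _] := svalP i; exact: iZ.
  have sp' x : V x -> s x <= p x.
    by move=> Vx; apply: le_trans (s_le a0 _ Aa0 Vx) _; have [_] := svalP a0; exact.
  by exists (exist _ s (conj ss sp')) => a Aa; apply/asboolP => x Vx; exact: s_le.
have [sD sZ] := ss.
have s_opp y : V y -> s (- y) = - s y.
  move=> Vy; apply/eqP; rewrite eq_le; apply/andP; split; last first.
    by have := sublinear_opp sV ss Vy; lra.
  (* The infimum over [t >= 0] of [s (x + t y) - t s(y)] is sublinear and below [s], so by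
     minimality it is not smaller than [s] anywhere. At [- y] the choice [t = 1] bounds it by
     [- s y]. *)
  have [|t x t0 Vx|t t' x x' t0 t0' Vx Vx'|t c x t0 c0 Vx|s' [ss' s'_le _]] :=
      @sublinear_inf V R [set t | 0 <= t] (fun t x => s (x + t *: y) - t * s y)
        (fun x => - s (- x)) sV.
  + by exists 0 => /=.
  + rewrite -(sublinearZ sV ss) //.
    have VtY : V (t *: y) by exact: VZ.
    have := sD _ _ (VD _ _ Vx VtY) (VN _ Vx).
    by rewrite addrAC subrr add0r; lra.
  + exists (t + t'); first exact: addr_ge0.
    have VY u : V (u *: y) by exact: VZ.
    have := sD _ _ (VD _ _ Vx (VY t)) (VD _ _ Vx' (VY t')).
    by rewrite addrACA -scalerDl; lra.
  + exists (c * t); first exact: mulr_ge0.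
    have VY u : V (u *: y) by exact: VZ.
    have := sZ c _ c0 (VD _ _ Vx (VY t)).
    by rewrite scalerDr scalerA mulrBr mulrA; lra.
  have s's x : V x -> s' x <= s x.
    by move=> Vx; have := s'_le 0 x (lexx 0) Vx; rewrite scale0r addr0 mul0r subr0.
  have s'p : sublinear_on V s' /\ forall x, V x -> s' x <= p x.
    by split=> // x Vx; apply: le_trans (s's _ Vx) (sp' _ Vx).
  have /smin/asboolP/(_ (- y) (VN _ Vy)) /= :
    le_op (exist _ s (conj ss sp')) (exist _ s' s'p) by apply/asboolP.
  have := s'_le 1 (- y) ler01 (VN _ Vy).
  by rewrite scale1r mul1r addNr (sublinear0 sV ss); lra.
exists s; split=> // [x y Vx Vy|t x Vx].
  apply/eqP; rewrite eq_le sD //= -lerBrDr -s_opp //.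
  by have := sD _ _ (VD _ _ Vx Vy) (VN _ Vy); rewrite addrK.
have [t0|t0] := leP 0 t; first exact: sublinearZ sV ss _ _ t0 Vx.
have Nt : 0 <= - t by rewrite oppr_ge0 ltW.
apply: oppr_inj; rewrite -s_opp; last exact: VZ.
by rewrite -mulNr -(sublinearZ sV ss) // scaleNr.
Qed.

(** The infimum of [p (x + t c) - t dl] over [t >= 0] and [c] in [C] is sublinear because [C] is
    convex, and at least [- p (- x)] because [dl <= p] on [C]. A linear functional [F] below it
    satisfies [F <= p] (take [t = 0]) and [F (- c) <= - dl] (take [t = 1]). *)
Lemma hahn_banach_separation V p C (dl : R) : linear_subspace V -> sublinear_on V p ->
    C `<=` V -> C !=set0 ->
    (forall x y (t : R), C x -> C y -> 0 <= t -> t <= 1 -> C (t *: x + (1 - t) *: y)) ->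
    (forall c, C c -> dl <= p c) ->
  exists F : L -> R, [/\ forall x y, V x -> V y -> F (x + y) = F x + F y,
    forall (t : R) x, V x -> F (t *: x) = t * F x, forall x, V x -> F x <= p x &
    forall c, C c -> dl <= F c].
Proof.
move=> sV sp CV [c0 Cc0] Cconv Cdl; have [V0 VD VZ] := sV; have [pD pZ] := sp.
have VN x : V x -> V (- x) by move=> Vx; rewrite -scaleN1r; exact: VZ.
have [|[t c] x /= [t0 Cc] Vx|[t c] [t' c'] x y /= [t0 Cc] [t0' Cc'] Vx Vy|[t c] a x /= [t0 Cc] a0 Vx
     |S [sS S_le _]] :=
    @sublinear_inf V (R * L)%type [set tc | 0 <= tc.1 /\ C tc.2]
      (fun tc x => p (x + tc.1 *: tc.2) - tc.1 * dl) (fun x => - p (- x)) sV.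
- by exists (0, c0).
- have Vtc : V (t *: c) by apply: VZ; exact: CV.
  have := pD _ _ (VD _ _ Vx Vtc) (VN _ Vx).
  rewrite addrAC subrr add0r (sublinearZ sV sp) //; last exact: CV.
  by have := ler_wpM2l t0 (Cdl _ Cc); lra.
- have Vtc : V (t *: c) by apply: VZ; exact: CV.
  have Vtc' : V (t' *: c') by apply: VZ; exact: CV.
  have pp := pD _ _ (VD _ _ Vx Vtc) (VD _ _ Vy Vtc').
  (* The witness is the average of [c] and [c'] with weights proportional to [t] and [t']; when both
     vanish, any point of [C] will do. *)
  have [tt0|tt0] := eqVneq (t + t') 0.
    have tz : t = 0 by lra.
    have tz' : t' = 0 by lra.
    exists (0, c) => /=; first by split.
    by move: pp; rewrite tz tz' !scale0r !addr0; lra.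
  have tt_gt0 : 0 < t + t' by rewrite lt_def tt0 addr_ge0.
  exists (t + t', (t / (t + t')) *: c + (1 - t / (t + t')) *: c') => /=.
    split; first exact: addr_ge0.
    apply: Cconv => //; first by rewrite divr_ge0 // ltW.
    by rewrite ler_pdivrMr // mul1r lerDl.
  move: pp; rewrite addrACA scalerDr !scalerA mulrBr mulr1 mulrC divfK //.
  by rewrite (_ : t + t' - t = t'); [lra|rewrite addrC addKr].
- exists (a * t, c) => /=; first by split; [exact: mulr_ge0|].
  have Vtc : V (t *: c) by apply: VZ; exact: CV.
  have := pZ a _ a0 (VD _ _ Vx Vtc).
  by rewrite scalerDr scalerA mulrBr mulrA; lra.
have [F [FD FZ F_le]] := hahn_banach_sublinear sV sS.
exists F; split=> // [x Vx|c Cc].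
  apply: le_trans (F_le _ Vx) _.
  by have := S_le (0, c0) x (conj (lexx _) Cc0) Vx; rewrite /= scale0r addr0 mul0r subr0.
have Vc := CV _ Cc.
have := F_le _ (VN _ Vc).
have := S_le (1, c) (- c) (conj ler01 Cc) (VN _ Vc).
rewrite /= scale1r mul1r addNr (sublinear0 sV sp) -(scaleN1r c) FZ //.
lra.
Qed.

End HahnBanach.

Section ModuleOfAction.
Context (R : nzRingType) (E : zmodType) (cs : R -> E -> E)
  (csA : forall a b x, cs a (cs b x) = cs (a * b) x) (cs1 : left_id 1 cs)
  (csDr : right_distributive cs +%R) (csDl : forall x, {morph cs^~ x : a b / a + b}).
(** Hahn-Banach is stated for an [lmodType], whereas the scalars acting on [E] are random variables.
    The real vector space structure given by the constants is attached to an alias of [E]. *)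
Let carrier : Type := E.
HB.instance Definition _ := GRing.Zmodule.on carrier.
HB.instance Definition _ := GRing.Zmodule_isLmodule.Build R carrier csA cs1 csDr csDl.
Definition module_of_action : lmodType R := carrier.
End ModuleOfAction.

(** * Almost sure comparison by means of test functions *)

Section TestComparison.
Context {d : measure_display} {T : measurableType d} {R : realType}
  (P : probability T R).
Implicit Types (a b k u : T -> R).

Lemma ae_boundedM_le k l u : rvR l -> ae_bounded P (fun t => k t * u t) -> rvR k ->
  {ae P, forall t, `|l t| <= u t} -> ae_bounded P (fun t => k t * l t).
Proof.
move=> ml bku mk lu; apply: ae_bounded_le bku _; first exact: measurable_funM.
apply: filterS lu => t h; rewrite !normrM ler_wpM2l //.
by apply: le_trans h _; exact: ler_norm.
Qed.

(** Test against [k = s ^ 2 * c], where [c] is the positive part of [a - b] and [s = (1 + u)^-1]: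
    the difference of the two expectations is that of [(s * c) ^ 2], so [c] vanishes almost surely.
    One factor [s] makes [s * c] bounded by 2, the other absorbs the weight [1 + u]. *)
Lemma ae_le_test a b u : rvR a -> rvR b -> rvR u ->
    (forall t, `|a t| <= u t) -> (forall t, `|b t| <= u t) ->
    (forall k, rvR k -> (forall t, 0 <= k t) -> ae_bounded P (fun t => k t * (1 + u t)) ->
       Ex P (fun t => k t * a t) <= Ex P (fun t => k t * b t)) ->
  {ae P, forall t, a t <= b t}.
Proof.
move=> ma mb mu au bu H.
have u0 t : 0 <= u t by apply: le_trans (au t).
have u1 t : 0 < 1 + u t by rewrite ltr_pwDl.
pose s t := (1 + u t)^-1; pose c t := Num.max (a t - b t) 0.
have s0 t : 0 < s t by rewrite invr_gt0.
have ms : rvR s.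
  by apply: measurable_funV_pos => //; apply: measurable_funD => //; exact: measurable_cst.
have mc : rvR c by apply: measurable_maxr; [exact: measurable_funB|exact: measurable_cst].
have c0 t : 0 <= c t by rewrite le_max lexx orbT.
have sc2 t : s t * c t <= 2.
  rewrite mulrC ler_pdivrMr // ge_max; have := ler_norm (a t); have := ler_norm (- b t).
  by rewrite normrN; have := au t; have := bu t; have := u0 t; move=> *; apply/andP; split; lra.
have sc0 t : 0 <= s t * c t by rewrite mulr_ge0 // ltW.
have bsc : ae_bounded P (fun t => s t * c t).
  apply: (@ae_bounded_ub _ _ _ _ _ 2); first exact: measurable_funM.
  by apply: aeW => t; rewrite ger0_norm.
pose k t := s t * (s t * c t).
have mk : rvR k by do 2![apply: measurable_funM => //].
have k0 t : 0 <= k t by rewrite mulr_ge0 // ltW.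
have bk : ae_bounded P (fun t => k t * (1 + u t)).
  by rewrite (_ : (fun t => _) = (fun t => s t * c t)) //; apply/funext => t;
     rewrite /k mulrAC mulVf ?mul1r // gt_eqF.
have bka : ae_bounded P (fun t => k t * a t).
  by apply: ae_boundedM_le ma bk mk _; apply: aeW => t; rewrite (le_trans (au t)) // lerDr.
have bkb : ae_bounded P (fun t => k t * b t).
  by apply: ae_boundedM_le mb bk mk _; apply: aeW => t; rewrite (le_trans (bu t)) // lerDr.
have sqE : (fun t => k t * a t - k t * b t) = (fun t => (s t * c t) * (s t * c t)).
  apply/funext => t; rewrite -mulrBr /k /c maxEle; case: ifP => ab; last by ring.
  by rewrite !mulr0 mul0r.
have E0 : Ex P (fun t => (s t * c t) * (s t * c t)) <= 0.
  by rewrite -sqE ExB // subr_le0; exact: H.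
have := Ex_eq0 (ae_boundedM bsc bsc) _ E0.
have h : {ae P, forall t, 0 <= (s t * c t) * (s t * c t)} by apply: aeW => t; rewrite mulr_ge0.
move=> /(_ h); apply: filterS => t /eqP; rewrite mulf_eq0 orbb mulf_eq0 gt_eqF //= => /eqP ct.
by rewrite -subr_le0 -ct /c le_max lexx.
Qed.

Lemma ae_eq_test a b u : rvR a -> rvR b -> rvR u ->
    (forall t, `|a t| <= u t) -> (forall t, `|b t| <= u t) ->
    (forall k, rvR k -> ae_bounded P (fun t => k t * (1 + u t)) ->
       Ex P (fun t => k t * a t) = Ex P (fun t => k t * b t)) ->
  {ae P, forall t, a t = b t}.
Proof.
move=> ma mb mu au bu H.
have h1 : {ae P, forall t, a t <= b t}.
  by apply: (@ae_le_test a b u) => // k mk _ bk; rewrite H.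
have h2 : {ae P, forall t, b t <= a t}.
  by apply: (@ae_le_test b a u) => // k mk _ bk; rewrite H.
by apply: filterS2 h1 h2 => t x y; apply/eqP; rewrite eq_le x y.
Qed.

End TestComparison.

(** * Random duals *)

Section RandomModule.
Context {d : measure_display} {T : measurableType d} {R : realType}
  (P : probability T R) (isC : bool) (E : zmodType) (sm : (T -> R[i]) -> E -> E)
  (I : Type) (nrm : I -> E -> T -> R).
Hypothesis HE : RLC_module P isC sm nrm.
Implicit Types (xi eta : T -> R) (x y : E) (Q : seq I).

(* Only real random scalars are used, so the cases [K = R] and [K = C] are treated at once. *)
Definition rscale (xi : T -> R) (x : E) : E := sm (toK xi) x.
Local Notation "xi *, x" := (rscale xi x) (at level 40).

Lemma rvK_toK xi : rvR xi -> rvK isC (toK xi).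
Proof. by move=> mxi; split. Qed.

Lemma rscaleDr xi x y : rvR xi -> xi *, (x + y) = xi *, x + xi *, y.
Proof. by case: HE => -[_ h _ _ _] _ _ mx; apply: h; exact: rvK_toK. Qed.

Lemma rscaleDl xi eta x : rvR xi -> rvR eta ->
  (fun t => xi t + eta t) *, x = xi *, x + eta *, x.
Proof.
case: HE => -[_ _ h _ _] _ _ mx me; rewrite /rscale -h; [|exact: rvK_toK..].
by congr sm; apply/funext => t; rewrite /toK rmorphD.
Qed.

Lemma rscaleA xi eta x : rvR xi -> rvR eta ->
  (fun t => xi t * eta t) *, x = xi *, (eta *, x).
Proof.
case: HE => -[_ _ _ h _] _ _ mx me; rewrite /rscale -h; [|exact: rvK_toK..].
by congr sm; apply/funext => t; rewrite /toK rmorphM.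
Qed.

Lemma rscale1 x : (fun=> 1) *, x = x.
Proof. by case: HE => -[_ _ _ _ h] _ _; rewrite -[RHS]h. Qed.

Lemma rv_cst (c : R) : rvR (fun _ : T => c). Proof. exact: measurable_cst. Qed.
Hint Resolve rv_cst : core.

Lemma rscale0 x : (fun=> 0) *, x = 0.
Proof.
apply: (@addrI _ ((fun=> 0) *, x)); rewrite addr0 -rscaleDl //.
by congr rscale; apply/funext => t; rewrite addr0.
Qed.

Lemma rscaleN1 x : (fun=> -1) *, x = - x.
Proof.
apply: (@addrI _ x); rewrite subrr -{1}(rscale1 x) -rscaleDl // -[RHS](rscale0 x).
by congr rscale; apply/funext => t; rewrite subrr.
Qed.

Lemma nrmQ_cons i Q x t : nrmQ nrm (i :: Q) x t = Num.max (nrm i x t) (nrmQ nrm Q x t).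
Proof. by rewrite /nrmQ big_cons. Qed.

Lemma nrmQ_nil x t : nrmQ nrm [::] x t = 0.
Proof. by rewrite /nrmQ big_nil. Qed.

(** The default value 0 of the maximum makes this hold at every point, although the seminorms are
    nonnegative only almost surely. *)
Lemma nrmQ_ge0 Q x t : 0 <= nrmQ nrm Q x t.
Proof. by elim: Q => [|i Q IH]; rewrite ?nrmQ_nil // nrmQ_cons le_max IH orbT. Qed.

Lemma nrmQ_rv Q x : rvR (nrmQ nrm Q x).
Proof.
elim: Q => [|i Q IH].
  by rewrite (_ : nrmQ _ _ _ = (fun=> 0)) //; apply/funext => t; rewrite nrmQ_nil.
rewrite (_ : nrmQ _ _ _ = (fun t => Num.max (nrm i x t) (nrmQ nrm Q x t))).
  by apply: measurable_maxr => //; have [_ /(_ i)[h _ _ _] _] := HE; exact: h.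
by apply/funext => t; rewrite nrmQ_cons.
Qed.

Lemma nrmQ_scale Q xi x : rvR xi ->
  {ae P, forall t, nrmQ nrm Q (xi *, x) t = `|xi t| * nrmQ nrm Q x t}.
Proof.
move=> mxi; elim: Q => [|i Q IH]; first by apply: aeW => t; rewrite !nrmQ_nil mulr0.
case: HE => _ /(_ i) [_ _ h _] _; have := h _ x (rvK_toK mxi).
apply: filterS2 IH => t IH; rewrite !nrmQ_cons IH => ->.
by rewrite /cmod /toK /= expr0n /= addr0 sqrtr_sqr maxr_pMr.
Qed.

Lemma nrmQD Q x y : {ae P, forall t, nrmQ nrm Q (x + y) t <= nrmQ nrm Q x t + nrmQ nrm Q y t}.
Proof.
elim: Q => [|i Q IH]; first by apply: aeW => t; rewrite !nrmQ_nil addr0.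
case: HE => _ /(_ i) [_ _ _ h] _; apply: filterS2 IH (h x y) => t IH {}h.
rewrite !nrmQ_cons ge_max (le_trans h) /=; last by rewrite lerD // le_max lexx.
by apply: le_trans IH _; rewrite lerD // le_max lexx orbT.
Qed.

Lemma nrmQ_cat Q Q' x t : nrmQ nrm Q x t <= nrmQ nrm (Q ++ Q') x t /\
  nrmQ nrm Q' x t <= nrmQ nrm (Q ++ Q') x t.
Proof.
elim: Q => [|i Q [IH1 IH2]] /=; first by rewrite nrmQ_nil nrmQ_ge0.
rewrite !nrmQ_cons; split; last by rewrite le_max IH2 orbT.
by rewrite ge_max !le_max lexx IH1 !orbT.
Qed.

Lemma nrmQN Q x : {ae P, forall t, nrmQ nrm Q (- x) t = nrmQ nrm Q x t}.
Proof.
rewrite -rscaleN1; apply: filterS (nrmQ_scale Q x (rv_cst (-1))) => t ->.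
by rewrite normrN normr1 mul1r.
Qed.

(** The random multiplier [c] in the bound keeps the class stable under multiplication by any random
    variable, which the tangents of squares and the norming functionals require. *)
Definition random_dual (f : E -> T -> R) : Prop :=
  [/\ forall x, rvR (f x),
      forall x y, {ae P, forall t, f (x + y) t = f x t + f y t},
      forall xi x, rvR xi -> {ae P, forall t, f (xi *, x) t = xi t * f x t} &
      exists Q c, rvR c /\ forall x, {ae P, forall t, `|f x t| <= c t * nrmQ nrm Q x t}].

Lemma random_dualB f x y : random_dual f ->
  {ae P, forall t, f (x - y) t = f x t - f y t}.
Proof.
case=> _ fD fZ _; apply: filterS2 (fD x (- y)) (fZ (fun=> -1) y (rv_cst (-1))) => t ->.
by rewrite rscaleN1 => ->; rewrite mulN1r.
Qed.

Lemma random_dual_conv f x y xi : random_dual f -> rvR xi ->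
  {ae P, forall t, f (xi *, x + (fun t => 1 - xi t) *, y) t = xi t * f x t + (1 - xi t) * f y t}.
Proof.
case=> _ fD fZ _ mxi.
have m1 : rvR (fun t => 1 - xi t) by exact: measurable_funB.
by apply: filterS3 (fD (xi *, x) ((fun t => 1 - xi t) *, y)) (fZ _ x mxi) (fZ _ y m1) => t -> -> ->.
Qed.

Lemma random_dual_scale b f : rvR b -> random_dual f -> random_dual (fun x t => b t * f x t).
Proof.
move=> mb [mf fD fZ [Q [c [mc fc]]]]; split.
- by move=> x; exact: (measurable_funM mb (mf x)).
- by move=> x y; apply: filterS (fD x y) => t ->; rewrite mulrDr.
- by move=> xi x mxi; apply: filterS (fZ xi x mxi) => t ->; rewrite mulrCA.
exists Q, (fun t => `|b t| * c t); split.
  by apply: measurable_funM => //; exact: measurableT_comp.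
by move=> x; apply: filterS (fc x) => t h; rewrite normrM -mulrA ler_wpM2l.
Qed.

Lemma random_dualD f g : random_dual f -> random_dual g ->
  random_dual (fun x t => f x t + g x t).
Proof.
move=> [mf fD fZ [Q [c [mc fc]]]] [mg gD gZ [Q' [c' [mc' gc]]]]; split.
- by move=> x; exact: (measurable_funD (mf x) (mg x)).
- by move=> x y; apply: filterS2 (fD x y) (gD x y) => t -> ->; rewrite addrACA.
- by move=> xi x mxi; apply: filterS2 (fZ xi x mxi) (gZ xi x mxi) => t -> ->; rewrite mulrDr.
exists (Q ++ Q'), (fun t => `|c t| + `|c' t|); split.
  by apply: measurable_funD; exact: measurableT_comp.
move=> x; apply: filterS2 (fc x) (gc x) => t h h'.
have [l1 l2] := nrmQ_cat Q Q' x t.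
rewrite (le_trans (ler_normD _ _)) // mulrDl lerD //.
  apply: le_trans h _; apply: le_trans (ler_wpM2r (nrmQ_ge0 _ _ _) (ler_norm _)) _.
  exact: ler_wpM2l.
apply: le_trans h' _; apply: le_trans (ler_wpM2r (nrmQ_ge0 _ _ _) (ler_norm _)) _.
exact: ler_wpM2l.
Qed.

Lemma random_dual0 : random_dual (fun _ _ => 0).
Proof.
split=> //; try by move=> *; apply: aeW => t; rewrite ?addr0 ?mulr0.
exists [::], (fun=> 0); split=> // x.
by apply: aeW => t; rewrite normr0 mul0r.
Qed.

(* Hahn-Banach gives a scalar functional [F] with [F <= Ex (w * nrmQ Q _)]; the random
   functional is [f x], the density of [k |-> F (k x)]. *)
Lemma random_hahn_banach Q (w : T -> R) (C : set E) (dl : R) :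
    rvR w -> (forall t, 0 < w t) -> Defs.convex_set sm C -> C !=set0 ->
    (forall c, C c -> ae_bounded P (fun t => w t * nrmQ nrm Q c t)) ->
    (forall c, C c -> dl <= Ex P (fun t => w t * nrmQ nrm Q c t)) ->
  exists f, [/\ random_dual f, forall x t, `|f x t| <= w t * nrmQ nrm Q x t &
    forall c, C c -> dl <= Ex P (f c)].
Proof.
move=> mw w0 Cconv C0 Cb Cdl.
pose cscale (a : R) (x : E) : E := (fun=> a) *, x.
have csA a b x : cscale a (cscale b x) = cscale (a * b) x by rewrite /cscale -rscaleA.
have csDr : right_distributive cscale +%R by move=> a x y; exact: rscaleDr.
have csDl x : {morph cscale^~ x : a b / a + b} by move=> a b; rewrite /cscale -rscaleDl.
pose L : lmodType R := module_of_action csA rscale1 csDr csDl.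
pose v x t := w t * nrmQ nrm Q x t.
have mv x : rvR (v x) by apply: measurable_funM => //; exact: nrmQ_rv.
have v0 x t : 0 <= v x t by rewrite mulr_ge0 ?nrmQ_ge0 // ltW.
have vZ xi x : rvR xi -> {ae P, forall t, v (xi *, x) t = `|xi t| * v x t}.
  by move=> mxi; apply: filterS (nrmQ_scale Q x mxi) => t h; rewrite /v h mulrCA.
have vD x y : {ae P, forall t, v (x + y) t <= v x t + v y t}.
  by apply: filterS (nrmQD Q x y) => t h; rewrite /v -mulrDr ler_wpM2l // ltW.
(* [F] lives on the subspace [V] only, but for every [x] of [E] the products [k x] with test
   functions [k] fall into [V] ([Vtest]), so the density [f x] is available on all of [E]. *)
pose V : set L := [set x | ae_bounded P (v x)].
have Vscale k x : rvR k -> ae_bounded P (fun t => k t * v x t) -> V (k *, x).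
  move=> mk bk; apply: ae_bounded_le bk _ => //.
  apply: filterS (vZ k x mk) => t ->.
  by rewrite !normrM normr_id.
have VD x y : V x -> V y -> V (x + y).
  move=> Vx Vy; apply: ae_bounded_le (ae_boundedD Vx Vy) _ => //.
  by apply: filterS (vD x y) => t h; rewrite !ger0_norm ?addr_ge0.
have sV : linear_subspace V.
  split=> //.
  - rewrite -(rscale0 0); apply: Vscale => //.
    rewrite (_ : (fun t => _) = (fun=> 0)); first exact: ae_bounded_cst.
    by apply/funext => t; rewrite mul0r.
  - by move=> a x Vx; apply: Vscale => //; exact: ae_boundedZ.
have sp : sublinear_on V (fun x => Ex P (v x)).
  split=> [x y Vx Vy|a x a0 Vx].
    by rewrite -ExD //; apply: Ex_le => //; [exact: VD|exact: ae_boundedD].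
  rewrite -ExZ //; apply: Ex_le; [|exact: ae_boundedZ|].
    by apply: Vscale => //; exact: ae_boundedZ.
  by apply: filterS (vZ (fun=> a) x (rv_cst a)) => t ->; rewrite ger0_norm.
have [F [FD FZ F_le FC]] := @hahn_banach_separation R L V _ C dl sV sp Cb C0 Cconv Cdl.
have Vtest x k : test_fun P (v x) k -> V (k *, x).
  move=> [mk bk]; apply: Vscale => //; apply: ae_boundedM_le bk mk _ => //.
  by apply: aeW => t; rewrite ger0_norm // lerDr.
have F_abs x : V x -> `|F x| <= Ex P (v x).
  move=> Vx; rewrite ler_norml F_le // andbT lerNl.
  have VNx : V (- x) by rewrite -rscaleN1; apply: Vscale => //; exact: ae_boundedZ.
  have -> : - F x = F (- x) by have := FZ (-1) x Vx; rewrite scaleN1r mulN1r.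
  apply: le_trans (F_le _ VNx) _; apply: Ex_le => //.
  by apply: filterS (nrmQN Q x) => t h; rewrite /v h.
have /choice[f fP] : forall x, exists g : T -> R, [/\ rvR g, forall t, `|g t| <= v x t &
    forall k, test_fun P (v x) k -> F (k *, x) = Ex P (fun t => k t * g t)].
  move=> x; apply: dual_L1 => //.
  - move=> k l tk tl; rewrite rscaleDl; [|by case: tk|by case: tl].
    by apply: FD; exact: Vtest.
  - move=> c k tk; rewrite rscaleA //; last by case: tk.
    by apply: FZ; exact: Vtest.
  - move=> k tk; apply: le_trans (F_abs _ (Vtest _ _ tk)) _; case: (tk) => mk bk.
    have bkv : ae_bounded P (fun t => `|k t| * v x t).
      apply: (@ae_bounded_le _ _ _ P _ _ _ bk).
        by apply: measurable_funM; [exact: (measurableT_comp (@normr_measurable R setT))|exact: mv].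
      apply: aeW => t; rewrite (normrM `|k t|) (normrM (k t)) normr_id (ger0_norm (v0 x t)).
      by rewrite (ger0_norm (addr_ge0 ler01 (v0 x t))) ler_wpM2l // lerDr.
    apply: Ex_le => //; first exact: Vtest.
    by apply: filterS (vZ _ x mk) => t ->.
have mf x : rvR (f x) by case: (fP x).
have f_le x t : `|f x t| <= v x t by case: (fP x).
exists f; split=> //.
- split=> //.
  + move=> x y.
    have mxy : rvR (fun t => v x t + v y t) := measurable_funD (mv x) (mv y).
    (* This sum dominates all three bounds, so a multiplier admissible for it is a test function for
       [x], [y] and [x + y] at once. *)
    have mu : rvR (fun t => v x t + v y t + v (x + y) t) := measurable_funD mxy (mv (x + y)).
    have vxy0 t : 0 <= v x t + v y t by rewrite addr_ge0.
    apply: (ae_eq_test (mf (x + y)) (measurable_funD (mf x) (mf y)) mu) => [t|t|k mk bk].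
    * by rewrite (le_trans (f_le _ _)) // lerDr.
    * by rewrite (le_trans (ler_normD _ _)) // -[leLHS]addr0 lerD // lerD.
    have tst z : (forall t, v z t <= v x t + v y t + v (x + y) t) -> test_fun P (v z) k.
      move=> h; split=> //; apply: ae_boundedM_le bk mk _.
        exact: (measurable_funD (rv_cst 1) (mv z)).
      by apply: aeW => t; rewrite (ger0_norm (addr_ge0 ler01 (v0 z t))) lerD2l.
    have tx : test_fun P (v x) k by apply: tst => t; rewrite -addrA lerDl addr_ge0.
    have ty : test_fun P (v y) k by apply: tst => t; rewrite addrAC lerDr addr_ge0.
    have txy : test_fun P (v (x + y)) k by apply: tst => t; rewrite lerDr addr_ge0.
    have [_ _ <-] := fP (x + y); last by [].
    rewrite (_ : (fun t => k t * (f x t + f y t)) =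
      (fun t => k t * f x t + k t * f y t)); last first.
      by apply/funext => t; rewrite mulrDr.
    have bf z : test_fun P (v z) k -> ae_bounded P (fun t => k t * f z t).
      move=> [_ bz]; apply: ae_boundedM_le bz mk _ => //.
      by apply: aeW => t; rewrite (le_trans (f_le _ _)) // lerDr.
    rewrite ExD; [|exact: bf..].
    have [_ _ <- //] := fP x; have [_ _ <- //] := fP y.
    by rewrite rscaleDr //; apply: FD; exact: Vtest.
  + move=> xi x mxi.
    have mn : rvR (fun t => `|xi t|) by exact: measurableT_comp.
    have mv1 z : rvR (fun t => 1 + v z t) := measurable_funD (rv_cst 1) (mv z).
    have mu : rvR (fun t => `|xi t| * (1 + v x t) + v (xi *, x) t) :=
      measurable_funD (measurable_funM mn (mv1 x)) (mv (xi *, x)).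
    have n0 t : 0 <= `|xi t| * (1 + v x t) by rewrite mulr_ge0 // addr_ge0.
    apply: (ae_eq_test (mf (xi *, x)) (measurable_funM mxi (mf x)) mu) => [t|t|k mk bk].
    * by rewrite (le_trans (f_le _ _)) // lerDr.
    * rewrite normrM; apply: (@le_trans _ _ (`|xi t| * (1 + v x t))).
        by rewrite ler_wpM2l // (le_trans (f_le _ _)) // lerDr.
      by rewrite lerDl.
    have t1 : test_fun P (v (xi *, x)) k.
      split=> //; apply: ae_boundedM_le bk mk _; first exact: mv1.
      by apply: aeW => t; rewrite (ger0_norm (addr_ge0 ler01 (v0 _ t))) lerD2l lerDr.
    have t2 : test_fun P (v x) (fun t => k t * xi t).
      split; first exact: measurable_funM.
      rewrite (_ : (fun t => _) = (fun t => k t * (xi t * (1 + v x t)))).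
        apply: ae_boundedM_le bk mk _.
          exact: (measurable_funM mxi (mv1 x)).
        apply: aeW => t; rewrite normrM (ger0_norm (addr_ge0 ler01 (v0 x t))).
        by rewrite addrCA lerDl addr_ge0.
      by apply/funext => t; rewrite mulrA.
    have [_ _ <- //] := fP (xi *, x).
    rewrite (_ : (fun t => k t * (xi t * f x t)) = (fun t => k t * xi t * f x t)); last first.
      by apply/funext => t; rewrite mulrA.
    by have [_ _ <- //] := fP x; rewrite rscaleA.
  exists Q, w; split=> // x; exact: aeW.
move=> c Cc; apply: le_trans (FC _ Cc) _.
have tc : test_fun P (v c) (fun=> 1).
  split=> //; rewrite (_ : (fun t => _) = (fun t => 1 + v c t)).
    by apply: ae_boundedD; [exact: ae_bounded_cst|exact: Cb].
  by apply/funext => t; rewrite mul1r.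
have [_ _ /(_ _ tc)] := fP c; rewrite rscale1 => ->.
by rewrite (_ : (fun t => 1 * f c t) = f c) //; apply/funext => t; rewrite mul1r.
Qed.

End RandomModule.

(** * Random convex functions and L0-convex compactness *)

Section RandomConvex.
Context {d : measure_display} {T : measurableType d} {R : realType}
  (P : probability T R) (isC : bool) (E : zmodType) (sm : (T -> R[i]) -> E -> E)
  (I : Type) (nrm : I -> E -> T -> R).
Hypothesis HE : RLC_module P isC sm nrm.
Variable i0 : I.
Local Notation "xi *, x" := (rscale sm xi x) (at level 40).
Local Notation dual := (random_dual P sm nrm).
Implicit Types (f g : E -> T -> R) (h k : T -> R) (u : E -> T -> R).

Lemma negligible_ae_not (A : set T) : measurable A ->
  {ae P, forall t, ~ A t} <-> Ex P \1_A = 0.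
Proof.
move=> mA; split=> [h|].
  have [B [mB PB AB]] := h; apply: EFin_inj; rewrite Ex_indic //.
  apply/eqP; rewrite -measure_le0 -PB; apply: le_measure; rewrite ?inE //.
  by move=> t At; apply: AB => /=; apply.
move=> A0; exists A; split=> //; first by rewrite -Ex_indic // A0.
by move=> t /= /contrapT.
Qed.

(** If [x] is outside, then for some [n] the event [N n] that [f x > h + e n] and [c <= n] has
    positive probability. For [y] near [x], the event that the seminorm of [y - x] is below
    [e n * e n] meets [N n], and there [f y] differs from [f x] by at most
    [n * e n * e n <= e n]. *)
Lemma halfspace_closed f h : dual f -> rvR h ->
  el_closed P nrm [set x | {ae P, forall t, f x t <= h t}].
Proof.
move=> df mh x /= nfh; have [mf _ _ [Q [c [mc fc]]]] := df.
pose e (n : nat) : R := n.+1%:R^-1.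
have e0 n : 0 < e n by rewrite invr_gt0.
pose N n := [set t | h t + e n < f x t] `&` [set t | c t <= n%:R].
have mN n : measurable (N n).
  apply: measurableI; last by apply: measurable_ler => //; exact: rv_cst.
  by apply: measurable_ltr => //; apply: measurable_funD => //; exact: rv_cst.
have [n pN] : exists n, 0 < Ex P \1_(N n).
  apply: contrapT => /forallNP pN; apply: nfh.
  have : {ae P, forall t, forall n, ~ N n t}.
    apply/ae_foralln => n; apply/negligible_ae_not => //.
    apply/eqP; rewrite eq_le; apply/andP; split.
      by rewrite leNgt; apply/negP/pN.
    by apply: Ex_ge0; [exact: measurable_indic|apply: aeW => t; rewrite indicE].
  apply: filterS => t nN; rewrite leNgt; apply/negP => hf.
  have d0 : 0 < f x t - h t by rewrite subr_gt0.
  pose b := Num.max (c t) (f x t - h t)^-1.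
  pose n := Num.bound `|b|.
  have nb : b < n%:R by apply: le_lt_trans (ler_norm _) _; exact: archi_boundP (normr_ge0 _).
  apply: (nN n); split=> /=.
    rewrite -ltrBrDl /e invf_plt ?posrE // (lt_trans (le_lt_trans _ nb)) ?ltr_nat //.
    by rewrite le_max lexx orbT.
  by apply: le_trans (ltW nb); rewrite le_max lexx.
have pN1 : Ex P \1_(N n) <= 1.
  rewrite -[leRHS](Ex_cst P); apply: Ex_le.
  - exact: ae_bounded_indic.
  - exact: ae_bounded_cst.
  - by apply: aeW => t; rewrite indicE lern1 leq_b1.
(* [Q] may be empty, while a basic neighbourhood needs at least one seminorm; hence [i0]. *)
exists (i0 :: Q), (e n * e n), (Ex P \1_(N n) / 2); split.
  by split=> //; [exact: mulr_gt0|lra|lra].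
move=> y Uy /= fyh.
pose S := [set t | nrmQ nrm (i0 :: Q) (y - x) t < e n * e n].
have mS : measurable S by apply: measurable_ltr; [exact: nrmQ_rv HE _ _|exact: rv_cst].
have := Uy; rewrite /Unbhd /= -/S -Ex_indic // lte_fin.
suff : Ex P \1_(N n) + Ex P \1_S <= 1 by lra.
rewrite -ExD; [|exact: ae_bounded_indic..]; rewrite -[leRHS](Ex_cst P); apply: Ex_le.
- by apply: ae_boundedD; exact: ae_bounded_indic.
- exact: ae_bounded_cst.
apply: filterS3 fyh (fc (y - x)) (random_dualB HE y x df) => t fyh fcyx fB.
rewrite !indicE; have [Nt|] := boolP (t \in N n); last by rewrite add0r lern1 leq_b1.
have [St|] := boolP (t \in S); last by rewrite addr0.
move: Nt St; rewrite !inE => -[/= Nt1 Nt2] /=; rewrite /S /= nrmQ_cons gt_max => /andP[_ St].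
exfalso; move: fcyx; rewrite fB => fcyx.
have q0 := nrmQ_ge0 nrm Q (y - x) t.
have h1 : c t * nrmQ nrm Q (y - x) t <= n%:R * (e n * e n).
  by apply: le_trans (ler_wpM2r q0 Nt2) _; rewrite ler_wpM2l // ltW.
have h2 : n%:R * (e n * e n) <= e n.
  by rewrite mulrA ler_piMl ?(ltW (e0 n)) // /e ler_pdivrMr // mul1r ler_nat.
have := ler_norm (- (f y t - f x t)); rewrite normrN; lra.
Qed.

(* Convexity and continuity at once: [u] has an affine minorant, with L0-linear part in the
   random dual, that touches it at any given point. *)
Definition random_convex u : Prop :=
  (forall x, rvR (u x)) /\
  forall x, exists g k, [/\ dual g, rvR k, {ae P, forall t, u x t = g x t + k t} &
    forall y, {ae P, forall t, g y t + k t <= u y t}].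

(** Evaluate at [x] and [y] the affine minorant that touches [u] at the convex combination. *)
Lemma random_convex_conv u xi x y : random_convex u -> rvR xi ->
    {ae P, forall t, 0 <= xi t <= 1} ->
  {ae P, forall t, u (xi *, x + (fun t => 1 - xi t) *, y) t <= xi t * u x t + (1 - xi t) * u y t}.
Proof.
move=> [_ cu] mxi xi01; have [g [k [dg _ uz uy]]] := cu (xi *, x + (fun t => 1 - xi t) *, y).
have gz := random_dual_conv x y dg mxi.
apply: filterS3 (filterI uz xi01) (filterI (uy x) (uy y)) gz => t [-> /andP[x0 x1]] [ux {}uy] ->.
have := ler_wpM2l x0 ux; have : 0 <= 1 - xi t by rewrite subr_ge0.
by move=> x1'; have := ler_wpM2l x1' uy; lra.
Qed.

Lemma sublevel_L0_convex u h : random_convex u ->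
  L0_convex P sm [set x | {ae P, forall t, u x t <= h t}].
Proof.
move=> cu x y xi /= xh yh mxi xi01.
apply: filterS3 (random_convex_conv x y cu mxi xi01) xi01 (filterI xh yh) => t H /andP[x0 x1] [a b].
apply: le_trans H _; have := ler_wpM2l x0 a; have : 0 <= 1 - xi t by rewrite subr_ge0.
by move=> x1'; have := ler_wpM2l x1' b; lra.
Qed.

(** A point outside the sublevel set is already outside the half-space of the minorant touching [u]
    there, which contains the sublevel set. *)
Lemma sublevel_closed u h : random_convex u -> rvR h ->
  el_closed P nrm [set x | {ae P, forall t, u x t <= h t}].
Proof.
move=> [mu cu] mh x /= nuh; have [g [k [dg mk ux uy]]] := cu x.
have mhk : rvR (fun t => h t - k t) by exact: measurable_funB.
have [|Q [eps [lam [bp H]]]] := halfspace_closed dg mhk (x := x).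
  by move=> /= gx; apply: nuh; apply: filterS2 gx ux => t; lra.
exists Q, eps, lam; split=> // y /H /= ngy uyh; apply: ngy.
by apply: filterS2 uyh (uy y) => t; lra.
Qed.

Lemma random_convex_dual f : dual f -> random_convex f.
Proof.
move=> df; split; first by case: df.
move=> x; exists f, (fun=> 0); split=> //; first exact: rv_cst.
- by apply: aeW => t; rewrite addr0.
- by move=> y; apply: aeW => t; rewrite addr0.
Qed.

Lemma random_convexD u v : random_convex u -> random_convex v ->
  random_convex (fun x t => u x t + v x t).
Proof.
move=> [mu cu] [mv cv]; split; first by move=> x; exact: (measurable_funD (mu x) (mv x)).
move=> x; have [g [k [dg mk ux uy]]] := cu x; have [g' [k' [dg' mk' vx vy]]] := cv x.
exists (fun x t => g x t + g' x t), (fun t => k t + k' t); split.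
- exact: random_dualD.
- exact: measurable_funD.
- by apply: filterS2 ux vx => t -> ->; rewrite addrACA.
- by move=> y; apply: filterS2 (uy y) (vy y) => t a b; rewrite addrACA lerD.
Qed.

Lemma random_convex_sqr f (phi : T -> R) : dual f -> rvR phi ->
  random_convex (fun x t => (f x t - phi t) ^+ 2).
Proof.
move=> df mphi; have [mf _ _ _] := df; have ma x : rvR (fun t => f x t - phi t).
  exact: (measurable_funB (mf x) mphi).
split=> [x|x]; first exact: (measurable_funX 2 (ma x)).
have m2 : rvR (fun t => 2 * (f x t - phi t)).
  exact: (measurable_funM (rv_cst 2) (ma x)).
(* The tangent at [x]; the gap to the square is [(f y - f x) ^ 2]. *)
exists (fun y t => 2 * (f x t - phi t) * f y t),
  (fun t => - (2 * (f x t - phi t) * phi t) - (f x t - phi t) ^+ 2); split.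
- exact: random_dual_scale.
- apply: measurable_funB; last exact: (measurable_funX 2 (ma x)).
  by apply: measurable_funN; exact: measurable_funM.
- by apply: aeW => t; ring.
- move=> y; apply: aeW => t; rewrite -subr_ge0.
  by rewrite [leRHS](_ : _ = (f y t - f x t) ^+ 2) ?sqr_ge0 //; ring.
Qed.

Lemma random_convex_sum (J : Type) (s : seq J) (u : J -> E -> T -> R) :
  (forall j, random_convex (u j)) -> random_convex (fun x t => \sum_(j <- s) u j x t).
Proof.
move=> cu; elim: s => [|j s IH].
  rewrite (_ : (fun x t => _) = (fun _ _ => 0)).
    exact/random_convex_dual/random_dual0.
  by do 2![apply/funext => ?]; rewrite big_nil.
rewrite (_ : (fun x t => _) = (fun x t => u j x t + \sum_(j <- s) u j x t)).
  exact: random_convexD.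
by do 2![apply/funext => ?]; rewrite big_cons.
Qed.

Section Attainment.
Variable G : set E.
Hypotheses (Gcl : el_closed P nrm G) (Gcv : L0_convex P sm G) (G0 : G !=set0).
Hypothesis Gcpt : family_compact P nrm (L0_convex P sm) G.

(** The form in which compactness of [G] is used throughout. An index is required because membership
    in [G] is read off one of the sets. *)
Lemma family_compact_sublevel (J : Type) (u : J -> E -> T -> R) (h : J -> T -> R) :
    inhabited J -> (forall j, random_convex (u j)) -> (forall j, rvR (h j)) ->
    (forall (n : nat) (s : 'I_n -> J),
       exists2 x, G x & forall i, {ae P, forall t, u (s i) x t <= h (s i) t}) ->
  exists2 x, G x & forall j, {ae P, forall t, u j x t <= h j t}.
Proof.
move=> [j0] cu mh H.
have [j|n s|x xP] := Gcpt (A := fun j => G `&` [set x | {ae P, forall t, u j x t <= h j t}]).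
- split; last exact: subIsetl.
  + move=> x y xi [Gx xh] [Gy yh] mxi xi01; split; first exact: Gcv.
    exact: sublevel_L0_convex.
  + move=> x; have := Gcl (x := x); have := sublevel_closed (cu j) (mh j) (x := x).
    have [Gx|nGx] := pselect (G x).
      move=> H1 _ /= nA; have [|Q [eps [lam [bp HU]]]] := H1.
        by move=> /= h1; apply: nA.
      by exists Q, eps, lam; split=> // y /HU nu [].
    move=> _ H1 _; have [//|Q [eps [lam [bp HU]]]] := H1.
    by exists Q, eps, lam; split=> // y /HU nu [].
- by have [x Gx xP] := H n s; exists x => k; split=> //; exact: xP.
by exists x => [|j]; [have [] := xP j0|have [] := xP j].
Qed.

(** Take [x] on the event that [u x <= u y] and [y] elsewhere. This makes the sublevel sets of [u]
    at its own values directed, hence gives them the finite intersection property, from which a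
    pointwise minimum results. *)
Lemma L0_convex_glue u x y : random_convex u -> G x -> G y -> exists2 z, G z &
  {ae P, forall t, u z t <= u x t} /\ {ae P, forall t, u z t <= u y t}.
Proof.
move=> cu Gx Gy; have [mu _] := cu.
have mB := measurable_ler (mu x) (mu y); set B := [set t | _] in mB.
have xi01 : {ae P, forall t, 0 <= (\1_B t : R) <= 1}.
  by apply: aeW => t; rewrite indicE lern1 leq_b1 ler0n.
have mxi : rvR (\1_B : T -> R) by exact: measurable_indic.
exists (\1_B *, x + (fun t => 1 - \1_B t) *, y); first exact: Gcv.
have H := random_convex_conv x y cu mxi xi01.
split; apply: filterS H => t; rewrite indicE; have [|] := boolP (t \in B).
- by rewrite subrr mul0r addr0 mul1r.
- rewrite notin_setE /B /= => /negP; rewrite -ltNge subr0 mul0r add0r mul1r => /ltW h.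
  by move/le_trans; apply.
- by rewrite inE /B /= subrr mul0r addr0 mul1r => h /le_trans; apply.
- by rewrite subr0 mul0r add0r mul1r.
Qed.

Lemma random_convex_attains_min u : random_convex u ->
  exists2 x, G x & forall y, G y -> {ae P, forall t, u x t <= u y t}.
Proof.
move=> cu; have [mu _] := cu; case: G0 => x0 Gx0.
pose J := {y | G y}.
have [||||x Gx xP] := @family_compact_sublevel J (fun=> u) (fun j => u (sval j)).
- by constructor; exists x0.
- by [].
- by move=> j; exact: mu.
- elim=> [|n IH] s; first by exists x0 => // -[].
  have [x Gx xP] := IH (fun i => s (lift ord0 i)).
  have [z Gz [zx zs]] := L0_convex_glue cu Gx (svalP (s ord0)).
  exists z => // k; have [k' ->|->] := unliftP ord0 k => //.
  by apply: filterS2 zx (xP k') => t; exact: le_trans.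
by exists x => // y Gy; exact: (xP (exist _ y Gy)).
Qed.

Lemma random_dual_bounded f : dual f -> exists x1 x2, [/\ G x1, G x2 &
  forall y, G y -> {ae P, forall t, `|f y t| <= `|f x1 t| + `|f x2 t|}].
Proof.
move=> df.
have dNf : dual (fun x t => - 1 * f x t) by apply: random_dual_scale => //; exact: rv_cst.
have [x1 Gx1 x1P] := random_convex_attains_min (random_convex_dual df).
have [x2 Gx2 x2P] := random_convex_attains_min (random_convex_dual dNf).
exists x1, x2; split=> // y Gy; apply: filterS2 (x1P _ Gy) (x2P _ Gy) => t a b.
have := ler_norm (- f x1 t); have := ler_norm (f x2 t); rewrite normrN => c e.
have := normr_ge0 (f x1 t); have := normr_ge0 (f x2 t); move=> n1 n2.
by rewrite ler_norml; apply/andP; split; lra.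
Qed.

End Attainment.
End RandomConvex.

(** * Boundedness of L0-convexly compact sets *)

Section Boundedness.
Context {d : measure_display} {T : measurableType d} {R : realType}
  (P : probability T R) (isC : bool) (E : zmodType) (sm : (T -> R[i]) -> E -> E)
  (I : Type) (nrm : I -> E -> T -> R).
Hypothesis HE : RLC_module P isC sm nrm.
Variable Q : seq I.
Local Notation "xi *, x" := (rscale sm xi x) (at level 40).
Local Notation dual := (random_dual P sm nrm).
Local Notation q := (nrmQ nrm Q).

(** Apply Hahn-Banach to the single point [y] with weight [(1 + q y)^-1] and the largest possible
    [dl]: then [f y] is below the weighted seminorm while its expectation is not smaller, which
    forces equality. Multiplying by [1 + q y] removes the weight. *)
Lemma random_dual_norming y : exists f,
  [/\ dual f, forall x t, `|f x t| <= q x t & {ae P, forall t, f y t = q y t}].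
Proof.
pose w t := (1 + q y t)^-1.
have q0 x t := nrmQ_ge0 nrm Q x t.
have mq x : rvR (q x) by exact: nrmQ_rv HE _ _.
have q1 t : 0 < 1 + q y t by rewrite ltr_pwDl.
have w0 t : 0 < w t by rewrite invr_gt0.
have mw : rvR w.
  by apply: measurable_funV_pos => //; exact: (measurable_funD (rv_cst 1) (mq y)).
have mwq : rvR (fun t => w t * q y t) by exact: (measurable_funM mw (mq y)).
have bwq : ae_bounded P (fun t => w t * q y t).
  apply: (@ae_bounded_ub _ _ _ _ _ 1) => //.
  apply: aeW => t; rewrite ger0_norm ?mulr_ge0 ?(ltW (w0 t)) // mulrC ler_pdivrMr //.
  by rewrite mul1r lerDr.
have cvy : Defs.convex_set sm [set y].
  move=> a b l /= -> -> l0 l1.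
  rewrite -[LHS]/((fun=> l) *, y + (fun=> (1 - l)) *, y).
  rewrite -(rscaleDl HE); [|exact: rv_cst..].
  by rewrite -[RHS](rscale1 HE); congr rscale; apply/funext => t; rewrite addrC subrK.
have [c ->|c ->|f [df f_le fy]] := @random_hahn_banach _ _ _ P isC E sm I nrm HE Q w [set y]
    (Ex P (fun t => w t * q y t)) mw w0 cvy (ex_intro _ y erefl).
- by [].
- by [].
have {}fy := fy y erefl.
have fyE : {ae P, forall t, w t * q y t - f y t = 0}.
  have bf : ae_bounded P (f y).
    apply: ae_bounded_le bwq _; first by case: df => m _ _ _.
    by apply: aeW => t; rewrite [leRHS]ger0_norm ?mulr_ge0 ?(ltW (w0 t)).
  apply: Ex_eq0; first exact: ae_boundedB.
    by apply: aeW => t; rewrite subr_ge0; apply: le_trans (f_le y t); exact: ler_norm.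
  by rewrite ExB // subr_le0.
have m1q : rvR (fun t => 1 + q y t) := measurable_funD (rv_cst 1) (mq y).
exists (fun x t => (1 + q y t) * f x t); split.
- exact: random_dual_scale.
- move=> x t; rewrite normrM (gtr0_norm (q1 t)) mulrC -ler_pdivlMr // mulrC.
  exact: f_le.
- apply: filterS fyE => t /eqP; rewrite subr_eq0 => /eqP <-.
  by rewrite mulrA mulfV ?mul1r // gt_eqF.
Qed.

Section Series.
Variables (g : nat -> E -> T -> R) (y : nat -> E).
Hypothesis dg : forall n, dual (g n).
Hypothesis g_le : forall n x t, `|g n x t| <= q x t.
Hypothesis g_y : forall n, {ae P, forall t, g n (y n) t = q (y n) t}.

(* The random signs make each new term reinforce the partial sum at [y n]. *)
Fixpoint signed_sum (n : nat) : E -> T -> R :=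
  if n is n'.+1 then
    fun x t => signed_sum n' x t +
      (if 0 <= signed_sum n' (y n') t then 1 else -1) * 3^-1 ^+ n' * g n' x t
  else fun _ _ => 0.

Let q0 x t : 0 <= q x t := nrmQ_ge0 nrm Q x t.

Lemma signed_sum_dual n : dual (signed_sum n).
Proof.
elim: n => [|n IH] /=; first exact: random_dual0.
apply: random_dualD => //; apply: random_dual_scale => //.
apply: (@measurable_funM _ _ _ _ _ (fun=> 3^-1 ^+ n)); last exact: rv_cst.
apply: measurable_fun_ifT; [|exact: rv_cst..].
apply: measurable_fun_ler; first exact: rv_cst.
by have [h _ _ _] := IH; exact: h.
Qed.

Let sign_norm n t : `|if 0 <= signed_sum n (y n) t then 1 else -1 : R| = 1.
Proof. by case: ifP; rewrite ?normrN normr1. Qed.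

Let pow_ge0 n : 0 <= (3^-1 : R) ^+ n. Proof. by rewrite exprn_ge0 // invr_ge0. Qed.

Let step n x t : `|signed_sum n.+1 x t - signed_sum n x t| <= 3^-1 ^+ n * q x t.
Proof.
rewrite /= addrAC subrr add0r !normrM sign_norm mul1r (ger0_norm (pow_ge0 n)).
by rewrite ler_wpM2l.
Qed.

(** The factor [1 - 3^-1 ^+ n] is the exact partial geometric sum, so the induction step is an
    equality of bounds. *)
Lemma signed_sum_dist m n x t :
  `|signed_sum (m + n) x t - signed_sum m x t| <= 3 / 2 * 3^-1 ^+ m * (1 - 3^-1 ^+ n) * q x t.
Proof.
elim: n => [|n IH]; first by rewrite addn0 subrr normr0 expr0 subrr mulr0 mul0r.
rewrite addnS; have := step (m + n) x t.
have := ler_normD (signed_sum (m + n).+1 x t - signed_sum (m + n) x t)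
  (signed_sum (m + n) x t - signed_sum m x t).
rewrite addrA subrK exprD [3^-1 ^+ n.+1]exprS => h1 h2.
apply: le_trans h1 _; apply: le_trans (lerD h2 IH) _.
by rewrite le_eqVlt; apply/orP; left; apply/eqP; field.
Qed.

Lemma signed_sum_near m n x t : (m <= n)%N ->
  `|signed_sum n x t - signed_sum m x t| <= 3 / 2 * 3^-1 ^+ m * q x t.
Proof.
move=> mn; rewrite -(subnKC mn); apply: le_trans (signed_sum_dist _ _ _ _) _.
rewrite -[leRHS]mulr1 -mulrA [_ * q x t]mulrC mulrA ler_wpM2l ?mulr_ge0 ?divr_ge0 // gerBl.
Qed.

Lemma signed_sum_large n : {ae P, forall t,
  3^-1 ^+ n * q (y n) t <= `|signed_sum n.+1 (y n) t|}.
Proof.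
apply: filterS (g_y n) => t /= ->; have u0 : 0 <= 3^-1 ^+ n * q (y n) t by rewrite mulr_ge0.
case: ifP => [s0|/negbT]; first by rewrite mul1r ger0_norm ?addr_ge0 // lerDr.
rewrite -ltNge => s0; rewrite ler0_norm; last by lra.
by lra.
Qed.

(** At [y n] the partial sum through term [n] is at least [3^-1 ^+ n * q (y n)], and the remaining
    terms total at most [3 / 2 * 3^-1 ^+ n.+1], half of that coefficient. Any ratio below 1/2 would
    leave a positive remainder in this way. *)
Lemma signed_series : exists f, dual f /\ forall n,
  {ae P, forall t, 2^-1 * 3^-1 ^+ n * q (y n) t <= `|f (y n) t|}.
Proof.
have cvg_s x t : cvgn (fun n => signed_sum n x t).
  apply/cauchy_cvgP; apply: cauchy_exP => e e0.
  have p0 : (fun n => 3 / 2 * 3^-1 ^+ n * q x t) @ \oo --> (0 : R).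
    rewrite -[0 : R](mul0r (q x t)); apply: cvgMl.
    rewrite -[0 : R](mulr0 (3 / 2)); apply: cvgMr.
    by apply: cvg_expr; rewrite ger0_norm ?invr_ge0 // invf_lt1 // ltr1n.
  move/cvgrPdist_lt : p0 => /(_ e e0) [n _ H].
  exists (signed_sum n x t), n => // i /= ni.
  have := H n (leqnn n); rewrite /= sub0r normrN => /(le_lt_trans (ler_norm _)) h.
  by rewrite /ball /= distrC; apply: le_lt_trans h; exact: signed_sum_near.
pose f x t := limn (fun n => signed_sum n x t).
have fcvg x t : (fun n => signed_sum n x t) @ \oo --> f x t by exact: cvg_s.
have f_near m x t : `|f x t - signed_sum m x t| <= 3 / 2 * 3^-1 ^+ m * q x t.
  have c : `|signed_sum n x t - signed_sum m x t| @[n --> \oo] --> `|f x t - signed_sum m x t|.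
    by apply: cvg_norm; apply: cvgB => //; exact: cvg_cst.
  have cc : (fun=> 3 / 2 * 3^-1 ^+ m * q x t) @ \oo --> 3 / 2 * 3^-1 ^+ m * q x t by exact: cvg_cst.
  apply: (ler_cvg_to c cc); exists m => // n /= mn; exact: signed_sum_near.
have mf x : rvR (f x).
  apply: (@measurable_fun_cvg _ _ _ _ (fun n => signed_sum n x)) => [n|t _ //].
  by have [h _ _ _] := signed_sum_dual n; exact: h.
exists f; split.
  split=> //.
  - move=> x x'; have /ae_foralln : forall n, {ae P, forall t,
      signed_sum n (x + x') t = signed_sum n x t + signed_sum n x' t}.
      by move=> n; have [_ h _ _] := signed_sum_dual n; exact: h.
    apply: filterS => t h; apply: cvg_lim => //.
    rewrite (_ : (fun n => _) = (fun n => signed_sum n x t + signed_sum n x' t)).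
      exact: cvgD.
    exact/funext.
  - move=> xi x mxi; have /ae_foralln : forall n, {ae P, forall t,
      signed_sum n (xi *, x) t = xi t * signed_sum n x t}.
      by move=> n; have [_ _ h _] := signed_sum_dual n; exact: h.
    apply: filterS => t h; apply: cvg_lim => //.
    rewrite (_ : (fun n => _) = (fun n => xi t * signed_sum n x t)).
      exact: cvgMr.
    exact/funext.
  - exists Q, (fun=> 3 / 2); split; first exact: rv_cst.
    move=> x; apply: aeW => t.
    by have := f_near 0%N x t; rewrite /= subr0 expr0 mulr1.
move=> n; apply: filterS (signed_sum_large n) => t h.
have := f_near n.+1 (y n) t; rewrite exprS.
have := ler_normD (signed_sum n.+1 (y n) t - f (y n) t) (f (y n) t).
rewrite subrK distrC => h1 h2.
rewrite (_ : 3 / 2 * (3^-1 * 3^-1 ^+ n) * q (y n) t =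
  2^-1 * (3^-1 ^+ n * q (y n) t)) in h2; last by field.
by rewrite -mulrA; lra.
Qed.

End Series.
End Boundedness.

(** * A positive random weight that bounds a seminorm on [G] *)

Section Weight.
Context {d : measure_display} {T : measurableType d} {R : realType}
  (P : probability T R) (isC : bool) (E : zmodType) (sm : (T -> R[i]) -> E -> E)
  (I : Type) (nrm : I -> E -> T -> R).
Hypothesis HE : RLC_module P isC sm nrm.
Variable i0 : I.
Variable Q : seq I.
Local Notation "xi *, x" := (rscale sm xi x) (at level 40).
Local Notation dual := (random_dual P sm nrm).
Local Notation q := (nrmQ nrm Q).

Lemma Ex_indic_le (A B : set T) : measurable A -> measurable B ->
  {ae P, forall t, A t -> B t} -> Ex P \1_A <= Ex P \1_B.
Proof.
move=> mA mB AB; apply: Ex_le; [exact: ae_bounded_indic..|].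
apply: filterS AB => t AB; rewrite !indicE ler_nat.
by have [/set_mem/AB/mem_set ->|] := boolP (t \in A).
Qed.

Lemma tail_small (h : T -> R) (dl : R) : rvR h -> 0 < dl ->
  exists n : nat, Ex P \1_[set t | n%:R < h t] < dl.
Proof.
move=> mh dl0; pose D n := [set t | (n%:R : R) < h t].
have mD n : measurable (D n) by apply: measurable_ltr => //; exact: rv_cst.
have muD0 : P (D n) @[n --> \oo] --> 0%E.
  have := @nonincreasing_cvg_mu _ _ _ P D.
  have -> : \bigcap_n D n = set0.
    apply/seteqP; split=> t //= H.
    have := H (Num.bound `|h t|) Logic.I; rewrite /D /= => /(lt_trans (archi_boundP (normr_ge0 _))).
    by rewrite ltNge ler_norm.
  rewrite measure0; apply => //.
  - by rewrite (le_lt_trans (probability_le1 _ _)) // ltry.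
  - move=> m n mn; apply/subsetPset => t; rewrite /D /=; apply: le_lt_trans.
    by rewrite ler_nat.
have /fine_cvgP[_ /cvgrPdist_lt/(_ _ dl0)[n _ /(_ n (leqnn n))]] := muD0.
rewrite /= sub0r normrN => H; exists n; apply: le_lt_trans H.
apply: le_trans (ler_norm _); rewrite le_eqVlt; apply/orP; left; apply/eqP.
by apply: EFin_inj; rewrite (Ex_indic P (mD n)) fineK // fin_num_measure.
Qed.

Lemma Ex_bigcup_le (B : nat -> set T) (c : R) : (forall n, measurable (B n)) ->
    (forall n m, (n <= m)%N -> B n `<=` B m) -> (forall n, Ex P \1_(B n) <= c) ->
  Ex P \1_(\bigcup_n B n) <= c.
Proof.
move=> mB ndB Bc; have mU : measurable (\bigcup_n B n) by exact: bigcupT_measurable.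
rewrite -lee_fin Ex_indic //.
have cv : (P \o B) n @[n --> \oo] --> P (\bigcup_n B n).
  by apply: nondecreasing_cvg_mu => // n m nm; apply/subsetPset; exact: ndB.
rewrite -(cvg_lim _ cv) //; apply: lime_le; first by apply/cvg_ex; eexists; exact: cv.
by apply: nearW => n /=; rewrite -Ex_indic // lee_fin.
Qed.

Let q0 x t : 0 <= q x t := nrmQ_ge0 nrm Q x t.
Let mq x : rvR (q x) := nrmQ_rv HE Q x.

Variable G : set E.
Hypotheses (Gcl : el_closed P nrm G) (Gcv : L0_convex P sm G) (G0 : G !=set0).
Hypothesis Gcpt : family_compact P nrm (L0_convex P sm) G.

(** Otherwise some [y n] in [G] exceed [2 * 3 ^+ n * n] with probability at least [dl]. The factor
    [2 * 3 ^+ n] cancels the loss in [signed_series], so [f (y n)] exceeds [n] on that event in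
    absolute value. But a functional is dominated on [G] by one random variable [M], whose tails
    tend to 0. *)
Lemma bounded_in_probability (dl : R) : 0 < dl ->
  exists n : nat, forall y, G y -> Ex P \1_[set t | n%:R < q y t] < dl.
Proof.
move=> dl0; apply: contrapT => /forallNP H.
have /choice[y yP] : forall n : nat, exists y, G y /\
    dl <= Ex P \1_[set t | 2 * 3 ^+ n * n%:R < q y t].
  move=> n; have /existsNP[y /not_implyP[Gy]] := H (2 * 3 ^ n * n)%N.
  move=> /negP; rewrite -leNgt => ?; exists y; split=> //.
  by rewrite -natrX -!natrM.
have /choice[g gP] := fun n => random_dual_norming HE Q (y n).
have [f [df fy]] := signed_series (fun n => let: And3 h _ _ := gP n in h)
  (fun n => let: And3 _ h _ := gP n in h) (fun n => let: And3 _ _ h := gP n in h).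
have [x1 [x2 [_ _ fM]]] := random_dual_bounded HE i0 Gcl Gcv G0 Gcpt df.
pose M t := `|f x1 t| + `|f x2 t|.
have mf x : rvR (f x) by have [h _ _ _] := df; exact: h.
have mM : rvR M by apply: measurable_funD; apply: measurableT_comp => //; exact: mf.
have [n] := tail_small mM dl0; apply/negP; rewrite -leNgt.
have [Gy] := yP n; move=> /le_trans; apply; apply: Ex_indic_le.
- by apply: measurable_ltr => //; exact: rv_cst.
- by apply: measurable_ltr => //; exact: rv_cst.
apply: filterS2 (fy n) (fM _ Gy) => t h1 h2 /= h3.
apply: lt_le_trans h2; apply: lt_le_trans h1.
rewrite exprVn -mulrA [_ * q _ _]mulrC mulrA ltr_pdivlMr ?exprn_gt0 // mulrC.
by lra.
Qed.

(** Convexity would bound [q z] only from above. The lower bounds come from idempotence of the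
    indicator [b]: [b z = b x] and [(1 - b) z = (1 - b) y], so [q z] agrees with [q x] or [q y] on
    each piece. *)
Lemma glue_max x y : G x -> G y -> exists2 z, G z &
  {ae P, forall t, q x t <= q z t} /\ {ae P, forall t, q y t <= q z t}.
Proof.
move=> Gx Gy.
have mB := measurable_ler (mq y) (mq x); set B := [set t | _] in mB.
have xi01 : {ae P, forall t, 0 <= (\1_B t : R) <= 1}.
  by apply: aeW => t; rewrite indicE lern1 leq_b1 ler0n.
pose b : T -> R := \1_B; pose b' t := 1 - b t.
have mb : rvR b by exact: measurable_indic.
have mb' : rvR b' by apply: measurable_funB => //; exact: rv_cst.
pose z := b *, x + b' *, y.
have Gz : G z by exact: Gcv.
have bb t : b t * b t = b t by rewrite /b indicE; case: (_ \in _); rewrite ?mulr1 ?mulr0.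
have bz : b *, z = b *, x.
  rewrite (rscaleDr HE) // -!(rscaleA HE) //.
  rewrite (_ : (fun t => b t * b t) = b); last exact/funext.
  rewrite (_ : (fun t => b t * b' t) = fun=> 0) ?(rscale0 HE) ?addr0 //.
  by apply/funext => t; rewrite mulrBr mulr1 bb subrr.
have b'z : b' *, z = b' *, y.
  rewrite (rscaleDr HE) // -!(rscaleA HE) //.
  rewrite (_ : (fun t => b' t * b' t) = b'); last first.
    by apply/funext => t; rewrite /b' mulrBr mulr1 mulrBl mul1r bb subrr subr0.
  rewrite (_ : (fun t => b' t * b t) = fun=> 0) ?(rscale0 HE) ?add0r //.
  by apply/funext => t; rewrite mulrBl mul1r bb subrr.
exists z => //.
have hx : {ae P, forall t, `|b t| * q x t = `|b t| * q z t}.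
  apply: filterS2 (nrmQ_scale HE Q x mb) (nrmQ_scale HE Q z mb) => t <- <-.
  by rewrite bz.
have hy : {ae P, forall t, `|b' t| * q y t = `|b' t| * q z t}.
  apply: filterS2 (nrmQ_scale HE Q y mb') (nrmQ_scale HE Q z mb') => t <- <-.
  by rewrite b'z.
split; apply: filterS2 hx hy => t; rewrite /b' /b indicE;
  have [tB|] := boolP (t \in B); rewrite ?subrr ?subr0 ?normr1 ?mul1r.
- by move=> ->.
- by rewrite notin_setE /B /= => /negP; rewrite -ltNge => /ltW h _ <-.
- by move=> <- _; move: tB; rewrite inE.
- by move=> _ _ ->.
Qed.

(* [w] is the infimum of [1 / (1 + q y)] along a sequence minimising its expectation over [G];
   gluing shows that it lies below all of them, boundedness in probability that it is
   positive. *)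
Lemma bounding_weight : exists w : T -> R, [/\ rvR w, forall t, 0 < w t &
  forall y, G y -> {ae P, forall t, w t * q y t <= 1}].
Proof.
pose r y t := (1 + q y t)^-1.
have q1 y t : 0 < 1 + q y t by rewrite ltr_pwDl.
have r0 y t : 0 < r y t by rewrite invr_gt0.
have r1 y t : r y t <= 1 by rewrite invf_le1 // lerDl.
have mr y : rvR (r y).
  by apply: measurable_funV_pos => //; exact: (measurable_funD (rv_cst 1) (mq y)).
have br y : ae_bounded P (r y).
  by apply: (@ae_bounded_ub _ _ _ _ _ 1) => //; apply: aeW => t; rewrite gtr0_norm.
pose s := inf [set Ex P (r y) | y in G].
have s_le y : G y -> s <= Ex P (r y).
  move=> Gy; apply: ge_inf; last by exists y.
  by exists 0 => _ [z _ <-]; apply: Ex_ge0 => //; apply: aeW => t; exact: ltW.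
have /choice[y yP] : forall n : nat, exists y, G y /\ Ex P (r y) < s + n.+1%:R^-1.
  move=> n; have hi : has_inf [set Ex P (r y) | y in G].
    split; first by case: G0 => x Gx; exists (Ex P (r x)), x.
    by exists 0 => _ [z _ <-]; apply: Ex_ge0 => //; apply: aeW => t; exact: ltW.
  have n0 : 0 < (n.+1%:R^-1 : R) by rewrite invr_gt0.
  by have [_ [z Gz <-] sz] := inf_adherent n0 hi; exists z.
pose w0 t := inf (range (fun n => r (y n) t)).
have lb t : has_lbound (range (fun n => r (y n) t)) by exists 0 => _ [n _ <-]; exact: ltW.
have w0_le n t : w0 t <= r (y n) t by apply: ge_inf => //; exists n.
have mw0 : rvR w0.
  have := @measurable_fun_infs _ _ _ setT (fun n => r (y n)) 0%N.
  move=> /(_ (fun t _ => lb t) (fun n => mr (y n))); congr (measurable_fun _ _).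
  by apply/funext => t; rewrite /infs /w0; congr inf; apply/seteqP; split=> _ [n _ <-]; exists n.
have w0_r x : G x -> {ae P, forall t, w0 t <= r x t}.
  move=> Gx; pose c t := Num.max (w0 t - r x t) 0.
  have bw0 : ae_bounded P w0.
    apply: ae_bounded_le mw0 (br (y 0%N)) _; apply: aeW => t.
    have w00 : 0 <= w0 t.
      by apply: lb_le_inf; [exists (r (y 0%N) t), 0%N|move=> _ [n _ <-]; exact: ltW].
    by rewrite ger0_norm // gtr0_norm.
  have mc : rvR c.
    apply: measurable_maxr; last exact: rv_cst.
    exact: (measurable_funB mw0 (mr x)).
  have c0 t : 0 <= c t by rewrite le_max lexx orbT.
  have bc : ae_bounded P c.
    apply: ae_bounded_le mc (ae_boundedD (ae_bounded_norm bw0) (br x)) _.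
    apply: aeW => t; rewrite (ger0_norm (c0 t)) (ger0_norm (addr_ge0 (normr_ge0 _) (ltW (r0 x t)))).
    rewrite /c ge_max addr_ge0 ?(ltW (r0 _ _)) // andbT.
    by have := ler_norm (w0 t); have := r0 x t; lra.
  (* Gluing [x] and [y n] into [z] gives [c + r z <= r (y n)]; as [Ex (r z) >= s], the
     near-minimality of [y n] leaves little room for [c]. *)
  have Ec n : Ex P c <= n.+1%:R^-1.
    have [Gy sy] := yP n; have [z Gz [zx zy]] := glue_max Gx Gy.
    have : Ex P (fun t => c t + r z t) <= Ex P (r (y n)).
      apply: Ex_le => //; first exact: ae_boundedD.
      apply: filterS2 zx zy => t hx hy; rewrite -lerBrDr /c ge_max.
      have hrx : r z t <= r x t by rewrite /r lef_pV2 ?posrE // lerD2l.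
      have hry : r z t <= r (y n) t by rewrite /r lef_pV2 ?posrE // lerD2l.
      by rewrite lerB //= subr_ge0.
    by rewrite ExD //; have := s_le _ Gz; move: (n.+1%:R^-1) sy => e sy; lra.
  have E0 : Ex P c <= 0.
    apply/ler_addgt0Pr => e e0; rewrite add0r.
    have eb : e^-1 < (Num.bound e^-1)%:R by apply: archi_boundP; rewrite invr_ge0 ltW.
    apply: le_trans (Ec (Num.bound e^-1)) _.
    by rewrite invf_ple ?posrE // (le_trans (ltW eb)) // ler_nat.
  have h0 : {ae P, forall t, 0 <= c t} by exact: aeW.
  apply: filterS (Ex_eq0 bc h0 E0) => t ct.
  by rewrite -subr_le0 -ct /c le_max lexx.
have w0_gt0 : {ae P, forall t, 0 < w0 t}.
  pose Z := [set t | w0 t <= 0].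
  have mZ : measurable Z by apply: measurable_ler => //; exact: rv_cst.
  suff : Ex P \1_Z = 0.
    by move=> /(negligible_ae_not _ mZ); apply: filterS => t /= /negP; rewrite -ltNge.
  apply/eqP; rewrite eq_le; apply/andP; split; last first.
    by apply: Ex_ge0; [exact: measurable_indic|apply: aeW => t; rewrite indicE].
  rewrite leNgt; apply/negP => Z0.
  have [|c cP] := bounded_in_probability (dl := Ex P \1_Z / 2); first lra.
  (* On [Z] the infimum is at most 0, so some [q (y k)] exceeds [c]: the [B n] cover [Z]. Yet gluing
     [y 0] to [y n] places [B n] in the event [q z > c] for a single [z] of [G], of probability
     below half that of [Z]. *)
  pose B n := \bigcup_(k < n.+1) [set t | c%:R < q (y k) t].
  have mA k : measurable [set t | c%:R < q (y k) t].
    by apply: measurable_ltr => //; exact: rv_cst.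
  have mB n : measurable (B n) by exact: bigcup_measurable.
  have : Ex P \1_(\bigcup_n B n) <= Ex P \1_Z / 2.
    apply: Ex_bigcup_le => // [n m nm|n].
      by move=> t [k /= kn h]; exists k => //=; exact: leq_trans kn _.
    have [z Gz zB] : exists2 z, G z & {ae P, forall t, B n t -> c%:R < q z t}.
      elim: n => [|n [z Gz zB]].
        exists (y 0%N); first by case: (yP 0%N).
        by apply: aeW => t [[|k] //= _].
      have [Gy _] := yP n.+1; have [z' Gz' [h1 h2]] := glue_max Gz Gy.
      exists z' => //; apply: filterS3 zB h1 h2 => t zB h1 h2 [k /=].
      rewrite ltnS leq_eqVlt => /orP[/eqP -> h|kn h]; first exact: lt_le_trans h2.
      by apply: lt_le_trans h1; apply: zB; exists k.
    apply: le_trans (ltW (cP _ Gz)); apply: Ex_indic_le => //.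
    by apply: measurable_ltr => //; exact: rv_cst.
  have : Ex P \1_Z <= Ex P \1_(\bigcup_n B n).
    apply: Ex_indic_le => //; first exact: bigcupT_measurable.
    apply: aeW => t Zt.
    have c1 : 0 < (c.+1%:R^-1 : R) by rewrite invr_gt0.
    have hi : has_inf (range (fun n => r (y n) t)) by split => //; exists (r (y 0%N) t), 0%N.
    have [_ [n _ <-] h] := inf_adherent c1 hi.
    exists n => //; exists n => //=.
    have : r (y n) t < c.+1%:R^-1 by apply: lt_le_trans h _; rewrite gerDr.
    by rewrite /r ltf_pV2 ?posrE // -natr1; lra.
  by lra.
exists (fun t => if 0 < w0 t then w0 t else 1); split.
- apply: measurable_fun_ifT; [|exact: mw0|exact: rv_cst].
  by apply: measurable_fun_ltr => //; exact: rv_cst.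
- by move=> t; case: ifP.
- move=> x Gx; apply: filterS2 w0_gt0 (w0_r _ Gx) => t -> h.
  apply: le_trans (ler_wpM2r (q0 x t) h) _.
  by rewrite mulrC ler_pdivrMr // mul1r lerDr.
Qed.

End Weight.

(** * Weak limits along an ultrafilter *)

Section WeakLimits.
Context {d : measure_display} {T : measurableType d} {R : realType}
  (P : probability T R) (E : zmodType).
Variable G : set E.
Variable U : set_system E.
Hypotheses (UU : UltraFilter U) (UG : U G).
Implicit Types (f g : E -> T -> R) (phi psi M b k : T -> R).

Lemma ultra_bounded_cvg (u : E -> R) (C : R) : (forall y, G y -> `|u y| <= C) ->
  cvg (u y @[y --> U]).
Proof.
move=> uC; have := @segment_compact R (- C) C; rewrite compact_ultra.
have UuU : UltraFilter (u y @[y --> U]).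
  split; first exact: fmap_proper_filter.
  move=> F FF uF; rewrite eqEsubset; split=> // A FA.
  have [//|UnA] := in_ultra_setVsetC (u @^-1` A) UU.
  have /filter_ex[z []] : F (A `&` ~` A) by apply: filterI => //; exact: uF.
  by [].
move=> /(_ (u y @[y --> U]) UuU) [|l [_ ul]].
  have h : U (fun y => u y \in `[- C, C]).
    by apply: filterS UG => y Gy; rewrite in_itv /= -ler_norml; exact: uC.
  exact: h.
by apply/cvg_ex; exists l.
Qed.

Lemma proper_cvg_le (f g : E -> R) (l l' : R) : f @ U --> l -> g @ U --> l' ->
  U (fun y => f y <= g y) -> l <= l'.
Proof.
move=> /cvgrPdist_le fl /cvgrPdist_le gl fg; apply/ler_addgt0Pr => e e0.
have e2 : 0 < e / 2 by rewrite divr_gt0.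
have Ul : U (fun y => `|l - f y| <= e / 2) by exact: fl.
have Ul' : U (fun y => `|l' - g y| <= e / 2) by exact: gl.
have [y [[h1 h2] h3]] := filter_ex (filterI (filterI Ul Ul') fg).
by move: h1 h2; rewrite !ler_norml => /andP[_ h1] /andP[h2 _]; lra.
Qed.

(* [phi] is the limit of [f] along [U] for the weak topology defined by the integrable
   multipliers [k] with [k * (1 + M)] bounded, [M] being a dominating random variable. *)
Definition weak_limit f phi M : Prop :=
  [/\ rvR phi /\ {ae P, forall t, `|phi t| <= M t},
      rvR M, forall t, 0 <= M t,
      (forall y, rvR (f y)) /\ (forall y, G y -> {ae P, forall t, `|f y t| <= M t}) &
      forall k, test_fun P M k ->
        Ex P (fun t => k t * f y t) @[y --> U] --> Ex P (fun t => k t * phi t)].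

Lemma test_bounded k M (g : T -> R) : test_fun P M k -> rvR M -> (forall t, 0 <= M t) -> rvR g ->
  {ae P, forall t, `|g t| <= M t} -> ae_bounded P (fun t => k t * g t).
Proof.
move=> [mk bk] mM M0 mg gM; apply: ae_boundedM_le mg bk mk _.
by apply: filterS gM => t /le_trans; apply; rewrite lerDr.
Qed.

(** For each multiplier [k] the bounded expectations converge along [U]. The limit is linear in [k]
    and dominated by [Ex (|k| * M)], so [dual_L1] represents it by a random variable. *)
Lemma weak_limit_exists f M : (forall y, rvR (f y)) -> rvR M -> (forall t, 0 <= M t) ->
    (forall y, G y -> {ae P, forall t, `|f y t| <= M t}) ->
  exists phi, weak_limit f phi M.
Proof.
move=> mf mM M0 fM.
have bM k : test_fun P M k -> ae_bounded P (fun t => `|k t| * M t).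
  move=> tk; have bkM := test_bounded tk mM M0 mM.
  case: (tk) => mk _; apply: ae_bounded_le (bkM _) _.
  - by apply: measurable_funM => //; exact: measurableT_comp.
  - by apply: aeW => t; rewrite ger0_norm.
  - by apply: aeW => t; rewrite !normrM normr_id.
have bkf k y : test_fun P M k -> G y -> ae_bounded P (fun t => k t * f y t).
  by move=> tk Gy; apply: test_bounded tk mM M0 (mf y) (fM _ Gy).
pose u k y := Ex P (fun t => k t * f y t).
have u_le k y : test_fun P M k -> G y -> `|u k y| <= Ex P (fun t => `|k t| * M t).
  move=> tk Gy; apply: le_trans (Ex_norm_le (bkf _ _ tk Gy)) _; apply: Ex_le.
  - exact/ae_bounded_norm/bkf.
  - exact: bM.
  - by apply: filterS (fM _ Gy) => t h; rewrite normrM ler_wpM2l.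
have u_cvg k : test_fun P M k -> u k y @[y --> U] --> lim (u k y @[y --> U]).
  by move=> tk; apply: (ultra_bounded_cvg (C := Ex P (fun t => `|k t| * M t))) => y; exact: u_le.
have [|k l tk tl|c k tk|k tk|phi [mphi phiM phiE]] :=
  @dual_L1 _ _ _ P M (fun k => lim (u k y @[y --> U])) mM.
- exact: M0.
- apply: cvg_lim => //; apply: cvg_trans (cvgD (u_cvg _ tk) (u_cvg _ tl)).
  apply: near_eq_cvg; apply: filterS UG => y Gy /=.
  rewrite -[LHS]/(u k y + u l y) /u -ExD; [|exact: bkf..].
  by congr Ex; apply/funext => t; rewrite mulrDl.
- have h : (c * u k y) @[y --> U] --> c * lim (u k y @[y --> U]) by apply: cvgMr; exact: u_cvg.
  apply: cvg_lim => //; apply: cvg_trans h.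
  apply: near_eq_cvg; apply: filterS UG => y Gy /=.
  rewrite /u -ExZ; last exact: bkf.
  by congr Ex; apply/funext => t; rewrite mulrA.
- have cn : `|u k y| @[y --> U] --> `|lim (u k y @[y --> U])|.
    by apply: cvg_norm; exact: u_cvg.
  have cc : (fun _ : E => Ex P (fun t => `|k t| * M t)) @ U --> Ex P (fun t => `|k t| * M t).
    exact: cvg_cst.
  have h : U (fun y => `|u k y| <= Ex P (fun t => `|k t| * M t)).
    by apply: filterS UG => y Gy; exact: u_le.
  exact: proper_cvg_le cn cc h.
exists phi; split; [by split=> //; exact: aeW|by []|by []|by []|].
move=> k tk; rewrite -phiE //; exact: u_cvg.
Qed.

(** The new dominating variable uses [1 + M] rather than [M] so that a multiplier [k] admissible for
    it makes [k * b] admissible for [M], even where [M] is small. *)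
Lemma weak_limit_scale b f phi M : rvR b -> weak_limit f phi M ->
  weak_limit (fun y t => b t * f y t) (fun t => b t * phi t) (fun t => `|b t| * (1 + M t)).
Proof.
move=> mb [[mphi phiM] mM M0 [mf fM] H].
have mnb : rvR (fun t => `|b t|) by exact: measurableT_comp.
have m1M : rvR (fun t => 1 + M t) := measurable_funD (rv_cst 1) mM.
have M1 t : 0 <= 1 + M t by rewrite addr_ge0.
have le1 t : M t <= 1 + M t by rewrite lerDr.
split.
- split; first exact: measurable_funM.
  by apply: filterS phiM => t h; rewrite normrM ler_wpM2l // (le_trans h).
- exact: measurable_funM.
- by move=> t; rewrite mulr_ge0.
- split; first by move=> y; exact: (measurable_funM mb (mf y)).
  by move=> y Gy; apply: filterS (fM _ Gy) => t h; rewrite normrM ler_wpM2l // (le_trans h).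
move=> k [mk bk].
have tkb : test_fun P M (fun t => k t * b t).
  split; first exact: measurable_funM.
  rewrite (_ : (fun t => _) = (fun t => k t * (b t * (1 + M t)))).
    apply: ae_boundedM_le bk mk _; first exact: measurable_funM.
    by apply: aeW => t; rewrite normrM (ger0_norm (M1 t)) lerDr.
  by apply/funext => t; rewrite mulrA.
have := H _ tkb.
have -> : Ex P (fun t => k t * (b t * phi t)) = Ex P (fun t => k t * b t * phi t).
  by congr Ex; apply/funext => t; rewrite mulrA.
suff -> : (fun y => Ex P (fun t => k t * (b t * f y t))) =
    (fun y => Ex P (fun t => k t * b t * f y t)) by [].
by apply/funext => y; congr Ex; apply/funext => t; rewrite mulrA.
Qed.

Lemma weak_limitD f g phi psi M M' : weak_limit f phi M -> weak_limit g psi M' ->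
  weak_limit (fun y t => f y t + g y t) (fun t => phi t + psi t) (fun t => M t + M' t).
Proof.
move=> [[mphi phiM] mM M0 [mf fM] H] [[mpsi psiM] mM' M0' [mg gM] H'].
split.
- split; first exact: measurable_funD.
  by apply: filterS2 phiM psiM => t h h'; rewrite (le_trans (ler_normD _ _)) // lerD.
- exact: measurable_funD.
- by move=> t; rewrite addr_ge0.
- split; first by move=> y; exact: (measurable_funD (mf y) (mg y)).
  move=> y Gy; apply: filterS2 (fM _ Gy) (gM _ Gy) => t h h'.
  by rewrite (le_trans (ler_normD _ _)) // lerD.
move=> k [mk bk].
have tM : test_fun P M k.
  split=> //; apply: ae_boundedM_le bk mk _; first exact: (measurable_funD (rv_cst 1) mM).
  by apply: aeW => t; rewrite ger0_norm ?addr_ge0 // lerD2l lerDl.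
have tM' : test_fun P M' k.
  split=> //; apply: ae_boundedM_le bk mk _; first exact: (measurable_funD (rv_cst 1) mM').
  by apply: aeW => t; rewrite ger0_norm ?addr_ge0 // lerD2l lerDr.
have -> : Ex P (fun t => k t * (phi t + psi t)) =
    Ex P (fun t => k t * phi t) + Ex P (fun t => k t * psi t).
  rewrite -ExD; [|exact: test_bounded tM mM M0 mphi phiM|exact: test_bounded tM' mM' M0' mpsi psiM].
  by congr Ex; apply/funext => t; rewrite mulrDr.
apply: cvg_trans (cvgD (H _ tM) (H' _ tM')).
apply: near_eq_cvg; apply: filterS UG => y Gy /=.
rewrite -[LHS]/(Ex P (fun t => k t * f y t) + Ex P (fun t => k t * g y t)) -ExD.
- by congr Ex; apply/funext => t; rewrite mulrDr.
- exact: test_bounded tM mM M0 (mf y) (fM _ Gy).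
- exact: test_bounded tM' mM' M0' (mg y) (gM _ Gy).
Qed.

Lemma weak_limit0 : weak_limit (fun _ _ => 0) (fun=> 0) (fun=> 0).
Proof.
split=> //; try exact: rv_cst.
- by split; [exact: rv_cst|apply: aeW => t; rewrite normr0].
- by split=> *; [exact: rv_cst|apply: aeW => t; rewrite normr0].
by move=> k _; exact: cvg_cst.
Qed.

Lemma weak_limit_sum (J : Type) (s : seq J) (f : J -> E -> T -> R) (phi : J -> T -> R) :
    (forall j, exists M, weak_limit (f j) (phi j) M) ->
  exists M, weak_limit (fun y t => \sum_(j <- s) f j y t) (fun t => \sum_(j <- s) phi j t) M.
Proof.
move=> H; elim: s => [|j s [M IH]].
  exists (fun=> 0); rewrite (_ : (fun y t => _) = (fun _ _ => 0)).
    rewrite (_ : (fun t => _) = (fun=> 0)); first exact: weak_limit0.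
    by apply/funext => ?; rewrite big_nil.
  by do 2![apply/funext => ?]; rewrite big_nil.
have [Mj Hj] := H j; exists (fun t => Mj t + M t).
rewrite (_ : (fun y t => _) = (fun y t => f j y t + \sum_(j <- s) f j y t)).
  rewrite (_ : (fun t => \sum_(j0 <- j :: s) phi j0 t) =
    (fun t => phi j t + \sum_(j <- s) phi j t)).
    exact: weak_limitD.
  by apply/funext => ?; rewrite big_cons.
by do 2![apply/funext => ?]; rewrite big_cons.
Qed.

Lemma weak_limit_ge g psi M b : weak_limit g psi M -> rvR b ->
    (forall y, G y -> {ae P, forall t, b t <= g y t}) ->
  {ae P, forall t, b t <= psi t}.
Proof.
move=> [[mpsi psiM] mM M0 [mg gM] H] mb bg.
pose u t := `|b t| + `|psi t| + M t.
have mu : rvR u.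
  by apply: measurable_funD => //; apply: measurable_funD; exact: measurableT_comp.
have n0 t : 0 <= `|b t| + `|psi t| by rewrite addr_ge0.
apply: (ae_le_test mb mpsi mu) => [t|t|k mk k0 bk].
- by rewrite /u -addrA lerDl addr_ge0.
- by rewrite /u addrAC lerDr addr_ge0.
have tM : test_fun P M k.
  split=> //; apply: ae_boundedM_le bk mk _; first exact: (measurable_funD (rv_cst 1) mM).
  by apply: aeW => t; rewrite ger0_norm ?addr_ge0 // lerD2l lerDr.
have bkb : ae_bounded P (fun t => k t * b t).
  apply: ae_boundedM_le bk mk _ => //.
  by apply: aeW => t; rewrite /u !addrA addrAC -!addrA addrCA lerDl !addr_ge0.
have cc : (fun _ : E => Ex P (fun t => k t * b t)) @ U --> Ex P (fun t => k t * b t).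
  exact: cvg_cst.
have h : U (fun y => Ex P (fun t => k t * b t) <= Ex P (fun t => k t * g y t)).
  apply: filterS UG => y Gy; apply: Ex_le => //.
    exact: test_bounded tM mM M0 (mg y) (gM _ Gy).
  by apply: filterS (bg _ Gy) => t h; rewrite ler_wpM2l.
exact: proper_cvg_le cc (H _ tM) h.
Qed.

End WeakLimits.

(** * One point of [G] for all weak limits *)

Section Attainment.
Context {d : measure_display} {T : measurableType d} {R : realType}
  (P : probability T R) (isC : bool) (E : zmodType) (sm : (T -> R[i]) -> E -> E)
  (I : Type) (nrm : I -> E -> T -> R).
Hypothesis HE : RLC_module P isC sm nrm.
Variable i0 : I.
Local Notation "xi *, x" := (rscale sm xi x) (at level 40).
Local Notation dual := (random_dual P sm nrm).
Variable G : set E.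
Hypotheses (Gcl : el_closed P nrm G) (Gcv : L0_convex P sm G) (G0 : G !=set0).
Hypothesis Gcpt : family_compact P nrm (L0_convex P sm) G.
Variable U : set_system E.
Hypotheses (UU : UltraFilter U) (UG : U G).

(** Divide by the step and let it tend to 0. Steps of the form [m.+1%:R^-1] are countably many, so
    their exceptional null sets can be collected before this is applied pointwise. *)
Lemma first_variation_ge0 (A S : R) :
  (forall m : nat, 0 <= 2 * m.+1%:R^-1 * A + m.+1%:R^-1 ^+ 2 * S) -> 0 <= A.
Proof.
move=> H; rewrite leNgt; apply/negP => A0.
pose m := Num.bound `|S / (- (2 * A))|.
have m0 : 0 < (m.+1%:R : R) by [].
have : S / (- (2 * A)) < m.+1%:R.
  apply: le_lt_trans (ler_norm _) _; apply: lt_trans (archi_boundP (normr_ge0 _)) _.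
  by rewrite ltr_nat.
rewrite ltr_pdivrMr => [h|]; last by lra.
have := H m; have -> : 2 * m.+1%:R^-1 * A + m.+1%:R^-1 ^+ 2 * S =
    m.+1%:R^-1 ^+ 2 * (2 * m.+1%:R * A + S) by field; rewrite gt_eqF.
by rewrite pmulr_rge0 ?exprn_gt0 ?invr_gt0 //; lra.
Qed.

(** First-order optimality: move from [x] towards [y] by a small constant step and expand the
    squares; the linear coefficient must be nonnegative. *)
Lemma least_squares_variation (n : nat) (f : 'I_n -> E -> T -> R) (phi : 'I_n -> T -> R) x y :
    (forall i, dual (f i)) -> (forall i, rvR (phi i)) -> G x -> G y ->
    (forall z, G z -> {ae P, forall t, \sum_(i <- enum 'I_n) (f i x t - phi i t) ^+ 2 <=
       \sum_(i <- enum 'I_n) (f i z t - phi i t) ^+ 2}) ->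
  {ae P, forall t, \sum_(i <- enum 'I_n) (f i x t - phi i t) * f i x t <=
    \sum_(i <- enum 'I_n) (f i x t - phi i t) * f i y t}.
Proof.
move=> df mphi Gx Gy xmin.
pose tm (m : nat) : R := m.+1%:R^-1.
have tm0 m : 0 <= tm m by rewrite invr_ge0.
have tm1 m : tm m <= 1 by rewrite invf_le1 // ler1n.
pose z m := (fun=> tm m) *, y + (fun t => 1 - (fun=> tm m) t) *, x.
have Gz m : G (z m).
  by apply: Gcv => //; [exact: rv_cst|apply: aeW => t; rewrite tm0 tm1].
have fz : {ae P, forall t, forall m i, f i (z m) t = tm m * f i y t + (1 - tm m) * f i x t}.
  apply/ae_foralln => m; apply: filter_forall => i.
  exact: random_dual_conv (df i) (rv_cst (tm m)).
have Jz : {ae P, forall t, forall m, \sum_(i <- enum 'I_n) (f i x t - phi i t) ^+ 2 <=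
    \sum_(i <- enum 'I_n) (f i (z m) t - phi i t) ^+ 2}.
  by apply/ae_foralln => m; exact: xmin.
apply: filterS2 fz Jz => t fz Jz; rewrite -subr_ge0 -sumrB.
apply: (@first_variation_ge0 _ (\sum_(i <- enum 'I_n) (f i y t - f i x t) ^+ 2)) => m.
have := Jz m; rewrite -subr_ge0 -sumrB; congr (_ <= _).
rewrite !mulr_sumr -big_split /=; apply: eq_bigr => i _.
by rewrite fz /tm; ring.
Qed.

(* Finitely many weak limits [phi_i] are attained at the point [x] of [G] minimising
   [sum_i (f_i x - phi_i) ^ 2]: pass to the limit in the variational inequality at [x]. *)
Lemma weak_limits_attained : exists2 x0, G x0 & forall f, dual f -> exists phi x1 x2,
  [/\ G x1, G x2, weak_limit P G U f phi (fun t => `|f x1 t| + `|f x2 t|) &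
      {ae P, forall t, phi t <= f x0 t}].
Proof.
pose D := {f | dual f}.
have dD (j : D) : dual (sval j) := svalP j.
have /choice[phi phiP] : forall j : D, exists phi, exists x1 x2, [/\ G x1, G x2 &
    weak_limit P G U (sval j) phi (fun t => `|sval j x1 t| + `|sval j x2 t|)].
  move=> j; have [x1 [x2 [Gx1 Gx2 fM]]] := random_dual_bounded HE i0 Gcl Gcv G0 Gcpt (dD j).
  have mf x : rvR (sval j x) by have [h _ _ _] := dD j; exact: h.
  have mM : rvR (fun t => `|sval j x1 t| + `|sval j x2 t|).
    by apply: measurable_funD; apply: measurableT_comp => //; exact: mf.
  have [|psi H] := weak_limit_exists UU UG mf mM _ fM.
    by move=> t; rewrite addr_ge0.
  by exists psi, x1, x2.
have mphi j : rvR (phi j) by have [x1 [x2 [_ _ [[h _] _ _ _ _]]]] := phiP j.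
(* The factor -1 turns [phi <= f x] into a sublevel condition, so compactness reduces all
   functionals at once to finitely many. *)
have [|j|j|n s|x0 Gx0 x0P] := @family_compact_sublevel _ _ _ P isC E sm I nrm HE i0 G Gcl Gcv Gcpt
    D (fun j x t => -1 * sval j x t) (fun j t => -1 * phi j t).
- by constructor; exists (fun _ _ => 0); exact: random_dual0.
- apply: random_convex_dual; apply: random_dual_scale; [exact: rv_cst|exact: dD].
- exact: (measurable_funM (rv_cst (-1)) (mphi j)).
- pose f i := sval (s i); pose ph i := phi (s i).
  have mf i x : rvR (f i x) by have [h _ _ _] := dD (s i); exact: h.
  have cu : random_convex P sm nrm (fun x t => \sum_(i <- enum 'I_n) (f i x t - ph i t) ^+ 2).
    by apply: random_convex_sum => i; apply: random_convex_sqr; [exact: dD|exact: mphi].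
  have [x Gx xmin] := random_convex_attains_min HE i0 Gcl Gcv G0 Gcpt cu.
  exists x => // k.
  pose a i t := f i x t - ph i t.
  have ma i : rvR (a i) := measurable_funB (mf i x) (mphi (s i)).
  have [M wl] : exists M, weak_limit P G U (fun y t => \sum_(i <- enum 'I_n) a i t * f i y t)
      (fun t => \sum_(i <- enum 'I_n) a i t * ph i t) M.
    apply: (weak_limit_sum UU UG) => i; have [x1 [x2 [_ _ H]]] := phiP (s i).
    by eexists; exact: weak_limit_scale (ma i) H.
  have mb : rvR (fun t => \sum_(i <- enum 'I_n) a i t * f i x t).
    by case: wl => _ _ _ [h _] _; exact: h.
  have ge : {ae P, forall t, \sum_(i <- enum 'I_n) a i t * f i x t <=
      \sum_(i <- enum 'I_n) a i t * ph i t}.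
    apply: (weak_limit_ge UU UG wl mb) => y Gy.
    by apply: least_squares_variation => // i; [exact: dD|exact: mphi].
  (* With everything on the left, [ge] says that the sum of the [a i ^+ 2] is at most 0, so each
     [a i] vanishes. *)
  apply: filterS ge => t; rewrite -subr_le0 -sumrB => h.
  rewrite !mulN1r lerN2.
  have /eqP : \sum_(i <- enum 'I_n) a i t ^+ 2 = 0.
    apply/eqP; rewrite eq_le sumr_ge0 ?andbT => [|i _]; last exact: sqr_ge0.
    apply: le_trans h; rewrite le_eqVlt; apply/orP; left; apply/eqP.
    by apply: eq_bigr => i _; rewrite -mulrBr expr2.
  rewrite psumr_eq0 => [/allP/(_ k (mem_enum _ k))|i _]; last exact: sqr_ge0.
  by rewrite /= sqrf_eq0 /a /f /ph subr_eq0 => /eqP <-.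
exists x0 => // f df; have [x1 [x2 [Gx1 Gx2 H]]] := phiP (exist _ f df).
exists (phi (exist _ f df)), x1, x2; split=> //.
by apply: filterS (x0P (exist _ f df)) => t; rewrite !mulN1r lerN2.
Qed.

End Attainment.

(** * The ultrafilter and the final separation *)

Lemma fip_ultrafilter (E : zmodType) (J : Type) (A : J -> set E) : fip A ->
  exists U : set_system E, UltraFilter U /\ forall j, U (A j).
Proof.
move=> Afip.
pose F : set_system E := [set B | exists (n : nat) (s : 'I_n -> J),
  forall x, (forall k, A (s k) x) -> B x].
have FF : ProperFilter F.
  split; first by move=> [n [s H]]; have [x /H] := Afip n s.
  split.
  - have s0 : 'I_0 -> J by case.
    by exists 0%N, s0.
  - move=> B B' [n [s H]] [n' [s' H']]; exists (n + n')%N.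
    exists (fun k => match fintype.split k with inl a => s a | inr b => s' b end) => x Hx.
    split; [apply: H => k; have := Hx (lshift n' k)|apply: H' => k; have := Hx (rshift n k)].
      by rewrite (unsplitK (inl k)).
    by rewrite (unsplitK (inr k)).
  - by move=> B B' BB' [n [s H]]; exists n, s => x /H; exact: BB'.
have [U [UU FU]] := ultraFilterLemma FF.
exists U; split=> // j; apply: FU.
by exists 1%N, (fun=> j) => x /(_ ord0).
Qed.

Theorem theorem5p3 (d : measure_display) (T : measurableType d) (R : realType)
  (P : probability T R) (isC : bool) (E : zmodType) (sm : (T -> R[i]) -> E -> E)
  (I : Type) (nrm : I -> E -> T -> R) (G : set E) :
  RLC_module P isC sm nrm ->
  el_complete P nrm ->
  el_closed P nrm G ->
  L0_convex P sm G ->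
  L0_convexly_compact P sm nrm G ->
  convexly_compact P sm nrm G.
Proof.
move=> HE _ Gcl Gcv [_ Gcpt]; split.
  move=> x y l Gx Gy l0 l1; apply: (Gcv x y (fun=> l)) => //; first exact: rv_cst.
  by apply: aeW => t; rewrite l0 l1.
move=> J A HA Afip; apply: contrapT => nA.
(* Some closed [A j] misses 0, and the basic neighbourhood that witnesses this involves at least one
   seminorm. *)
have i0 : inhabited I.
  have /existsNP[j nAj] : ~ forall j, A j 0 by move=> h; apply: nA; exists 0.
  have [_ Acl _] := HA j; have [[|i Q] [eps [lam [[Q0 _ _ _] _]]]] := Acl 0 nAj; first by case: Q0.
  by constructor.
have [j0] : inhabited J.
  apply: contrapT => nJ; apply: nA; exists 0 => j; case: nJ; constructor; exact: j.
case: i0 => i0.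
have [U [UU UA]] := fip_ultrafilter Afip.
have UG : U G by apply: filterS (UA j0); case: (HA j0).
have G0 : G !=set0 by exact: filter_ex UG.
have [x0 Gx0 x0P] := weak_limits_attained HE i0 Gcl Gcv G0 Gcpt UU UG.
apply: nA; exists x0 => j; apply: contrapT => nAj.
have [Aconv Acl AG] := HA j.
have [Q [eps [lam [[_ eps0 lam0 lam1] Unb]]]] := Acl x0 nAj.
have [w [mw w0 wG]] := bounding_weight HE i0 Q Gcl Gcv G0 Gcpt.
pose q := nrmQ nrm Q.
have mq x : rvR (q x) := nrmQ_rv HE Q x.
have q0 x t : 0 <= q x t := nrmQ_ge0 nrm Q x t.
have mwq x : rvR (fun t => w t * q x t) := measurable_funM mw (mq x).
have wq0 x t : 0 <= w t * q x t by rewrite mulr_ge0 // ltW.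
pose C : set E := [set c | A j (c + x0)].
have Cb c : C c -> ae_bounded P (fun t => w t * q c t).
  move=> Cc; apply: (@ae_bounded_ub _ _ _ _ _ 2) => //.
  have := nrmQD HE Q (c + x0) (- x0); rewrite addrK => h.
  apply: filterS3 (filterI h (nrmQN HE Q x0)) (wG _ (AG _ Cc)) (wG _ Gx0) => t [h1 h2] h3 h4.
  rewrite ger0_norm //; apply: le_trans (ler_wpM2l (ltW (w0 t)) h1) _.
  by rewrite h2 mulrDr; lra.
have Cconv : Defs.convex_set sm C.
  move=> c c' l Cc Cc' l0 l1; have := Aconv _ _ l Cc Cc' l0 l1; rewrite /C /=.
  have ml := @rv_cst _ T R l; have ml' := @rv_cst _ T R (1 - l).
  suff -> : sm (fun=> l%:C%C) (c + x0) + sm (fun=> (1 - l)%:C%C) (c' + x0) =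
    sm (fun=> l%:C%C) c + sm (fun=> (1 - l)%:C%C) c' + x0 by [].
  transitivity (rscale sm (fun=> l) (c + x0) + rscale sm (fun=> 1 - l) (c' + x0)); first by [].
  rewrite (rscaleDr HE c x0 ml) (rscaleDr HE c' x0 ml') addrACA.
  rewrite -[X in _ + X](rscaleDl HE x0 ml ml').
  rewrite (_ : (fun t : T => l + (1 - l)) = fun=> 1) ?(rscale1 HE) //.
  by apply/funext => t; rewrite addrC subrK.
have C0 : C !=set0.
  by have [y Ay] := filter_ex (UA j); exists (y - x0); rewrite /C /= subrK.
have mwV : rvR (fun t => (w t)^-1) by exact: measurable_funV_pos.
have lam2 : 0 < lam / 2 by rewrite divr_gt0.
have [n nP] := tail_small P mwV lam2.
(* For [c] in [C], the event [q c >= eps] has probability at least [lam], and [w >= n.+1%:R^-1]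
   fails with probability below [lam / 2]. So [w * q c >= kap] with probability at least [lam / 2],
   whence [dl]. *)
pose kap : R := eps / n.+1%:R.
have kap0 : 0 < kap by rewrite divr_gt0.
pose dl := kap * (lam / 2).
have dl0 : 0 < dl by rewrite mulr_gt0.
have Cdl c : C c -> dl <= Ex P (fun t => w t * q c t).
  move=> Cc; pose S1 := [set t | q c t < eps]; pose S2 := [set t | n%:R < (w t)^-1].
  have mS1 : measurable S1 by apply: measurable_ltr => //; exact: rv_cst.
  have mS2 : measurable S2 by apply: measurable_ltr => //; exact: rv_cst.
  have b1 := ae_bounded_indic P mS1; have b2 := ae_bounded_indic P mS2.
  have bc := ae_bounded_cst P (1 : R).
  have S1le : Ex P \1_S1 <= 1 - lam.
    rewrite leNgt; apply/negP => h; apply: (Unb (c + x0)) => //.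
    by rewrite addrK /Unbhd /= -/q -/S1 -Ex_indic // lte_fin.
  have : Ex P (fun t => kap * (1 - \1_S1 t - \1_S2 t)) <= Ex P (fun t => w t * q c t).
    apply: Ex_le; [|exact: Cb|].
      by apply: ae_boundedZ; apply: ae_boundedB => //; exact: ae_boundedB.
    apply: aeW => t; rewrite !indicE.
    have [tS1|tS1] := boolP (t \in S1).
      by rewrite subrr sub0r mulrN; apply: le_trans (wq0 c t); rewrite oppr_le0 mulr_ge0 // ltW.
    have [tS2|tS2] := boolP (t \in S2).
      by rewrite subr0 subrr mulr0.
    rewrite !subr0 mulr1.
    move: tS1 tS2; rewrite !notin_setE /S1 /S2 /= => /negP; rewrite -leNgt => tS1 /negP.
    rewrite -leNgt => tS2; have wn : n.+1%:R^-1 <= w t.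
      rewrite -[leRHS]invrK lef_pV2 ?posrE ?invr_gt0 //.
      by apply: le_trans tS2 _; rewrite ler_nat.
    by rewrite /kap mulrC; apply: ler_pM => //; exact: ltW.
  rewrite ExZ; last by apply: ae_boundedB => //; exact: ae_boundedB.
  rewrite ExB //; last exact: ae_boundedB.
  rewrite ExB // Ex_cst; apply: le_trans.
  rewrite /dl ler_wpM2l // ?(ltW kap0) //.
  by move: nP; rewrite -/S2; lra.
have [f [df f_le fC]] := random_hahn_banach HE mw w0 Cconv C0 Cb Cdl.
have [phi [x1 [x2 [Gx1 Gx2 [[mphi phiM] mM M0 [mf fM] H] phi_le]]]] := x0P f df.
(* Thanks to the weight, [f] is bounded on [G]; the constant 1 is then a test function and the weak
   limit becomes a limit of expectations. *)
have fw y : G y -> {ae P, forall t, `|f y t| <= 1}.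
  by move=> Gy; apply: filterS (wG _ Gy) => t h; exact: le_trans (f_le y t) h.
have bf y : G y -> ae_bounded P (f y).
  by move=> Gy; apply: (@ae_bounded_ub _ _ _ _ _ 1) => //; exact: fw.
have bM : ae_bounded P (fun t => `|f x1 t| + `|f x2 t|).
  by apply: ae_boundedD; apply: ae_bounded_norm; exact: bf.
have t1 : test_fun P (fun t => `|f x1 t| + `|f x2 t|) (fun=> 1).
  split; first exact: rv_cst.
  rewrite (_ : (fun t => _) = (fun t => 1 + (`|f x1 t| + `|f x2 t|))).
    by apply: ae_boundedD => //; exact: ae_bounded_cst.
  by apply/funext => t; rewrite mul1r.
have bphi : ae_bounded P phi.
  apply: ae_bounded_le mphi bM _; apply: filterS phiM => t.
  by rewrite [X in _ -> _ <= X]ger0_norm.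
have Elim : Ex P (f y) @[y --> U] --> Ex P phi.
  have -> : Ex P phi = Ex P (fun t => 1 * phi t).
    by congr Ex; apply/funext => t; rewrite mul1r.
  rewrite (_ : (fun y => Ex P (f y)) = (fun y => Ex P (fun t => 1 * f y t))); first exact: H.
  by apply/funext => y; congr Ex; apply/funext => t; rewrite mul1r.
have Ephi : Ex P phi <= Ex P (f x0) by apply: Ex_le => //; exact: bf.
have cc : (fun _ : E => Ex P (f x0) + dl) @ U --> Ex P (f x0) + dl by exact: cvg_cst.
have UAf : U (fun y => Ex P (f x0) + dl <= Ex P (f y)).
  apply: filterS (UA j) => y Ay; have Cy : C (y - x0) by rewrite /C /= subrK.
  rewrite addrC -lerBrDr -ExB; [|exact/bf/AG|exact: bf].
  apply: le_trans (fC _ Cy) _; rewrite le_eqVlt; apply/orP; left; apply/eqP.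
  apply: Ex_eq.
  - by apply: ae_bounded_le (Cb _ Cy) _ => //; apply: aeW => t; rewrite [leRHS]ger0_norm.
  - by apply: ae_boundedB; [exact/bf/AG|exact: bf].
  - have h := random_dualB HE y x0 df; exact: h.
by have := proper_cvg_le UU cc Elim UAf; lra.
Qed.
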